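(* Let $F=(F_n)_n$ be a sequence with $F_n\in\Lambda^{(n)}$. Then: - $F$ is $s$-stable if and only if it is $m$-stable; - $F$ is uniformly $s$-stable if and only if it is uniformly $h$-stable; - $F$ is $h$-stable if and only if it is $p/z$-stable; - $F$ is uniformly $m$-stable if and only if it is uniformly $p$-stable. Moreover, for partitions $\lambda,\mu$ with $|\lambda|\le|\mu|$, $$N^{s\to m}_{\lambda,\mu},\ N^{m\to s}_{\lambda,\mu}\le 2|\mu|,\qquad N^{p/z\to h}_{\lambda,\mu},\ N^{h\to p/z}_{\lambda,\mu}\le 2|\mu|+1,$$ and for all partitions $\mu$ (respectively $\lambda$) $$J^{s\to m}_\mu,\ J^{m\to s}_\mu,\ J^{p/z\to h}_\mu,\ J^{h\to p/z}_\mu\subseteq\{\lambda : |\lambda|\le|\mu|\},$$ $$I^{p\to m}_\lambda,\ I^{m\to p}_\lambda,\ I^{h\to s}_\lambda,\ I^{s\to h}_\lambda\subseteq\{\mu : |\mu|\le|\lambda|\}.$$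
   Context: $\Lambda$ is the algebra of symmetric functions over $\mathbb{C}$, $\Lambda^{(n)}$ its degree-$n$ part. The bases $m,s,h,p,p/z$ are: monomial $m_\lambda$, Schur $s_\lambda$, complete homogeneous $h_\lambda$, power sum $p_\lambda$, and $p_\lambda/z_\lambda$, where $z_\lambda=\prod_j j^{c_j}c_j!$ with $c_j$ the number of parts of $\lambda$ equal to $j$. For a partition $\lambda=(\lambda_1,\dots,\lambda_l)$ and $n$ with $n-|\lambda|\ge\lambda_1$ (with $\lambda_1=0$ if $\lambda=\emptyset$), $\lambda[n]:=(n-|\lambda|,\lambda_1,\dots,\lambda_l)\vdash n$; otherwise $\lambda[n]$ is undefined. For a basis $(f_\lambda)$ with $f_\lambda\in\Lambda^{(|\lambda|)}$ write $F_n=\sum_\lambda d_{\lambda,n}f_{\lambda[n]}$, with $d_{\lambda,n}=0$ if $\lambda[n]$ is undefined. $\mathrm{rg}^f_\lambda(F_\bullet)$ is the smallest $n$ with $d_{\lambda,n}=d_{\lambda,n+k}$ for all $k\ge0$ ($\infty$ if none). $F$ is $f$-stable if $\mathrm{rg}^f_\lambda(F_\bullet)<\infty$ for all $\lambda$, and uniformly $f$-stable if $\max_\lambda \mathrm{rg}^f_\lambda(F_\bullet)<\infty$. For two such bases with $f_\lambda=\sum_{\mu\vdash|\lambda|}A_{\lambda,\mu}g_\mu$, set $A_{\lambda[n],\mu[n]}=0$ whenever $\lambda[n]$ or $\mu[n]$ is undefined. $N^{f\to g}_{\lambda,\mu}$ is the smallest $n$ with $A_{\lambda[n],\mu[n]}=A_{\lambda[n+k],\mu[n+k]}$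 for all $k\ge0$ ($\infty$ if none); $J^{f\to g}_\mu:=\{\lambda:\exists n,\ A_{\lambda[n],\mu[n]}\ne0\}$; $I^{f\to g}_\lambda:=\{\mu:\exists n,\ A_{\lambda[n],\mu[n]}\ne0\}$. *)

(* Defs.v *)
From HB Require Import structures.
From mathcomp Require Import all_boot all_order all_fingroup all_algebra.
From mathcomp Require Import boolp classical_sets reals.
From mathcomp Require Import complex.
From mathcomp Require Import mpoly.

Set Implicit Arguments.
Unset Strict Implicit.
Unset Printing Implicit Defensive.

Import GRing.Theory.

Local Open Scope ring_scope.

Definition is_part (s : seq nat) : bool := sorted geq s && (0%N \notin s).

Record intpart : Type := IntPart { parts :> seq nat; _ : is_part parts }.

HB.instance Definition _ := [isSub for parts].
HB.instance Definition _ := [Countable of intpart by <:].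

Definition psize (la : intpart) : nat := sumn la.

Record intpartn (n : nat) : Type :=
  IntPartn { intpartn_val :> intpart; _ : psize intpartn_val == n }.

HB.instance Definition _ n := [isSub for @intpartn_val n].
HB.instance Definition _ n := [Countable of intpartn n by <:].

Section IntPartnFinite.
Variable n : nat.

Let code (la : intpartn n) : n.-bseq 'I_n.+1 := insub_bseq n (map inord la).
Let decode (t : n.-bseq 'I_n.+1) : option (intpartn n) :=
  obind insub (insub (map val t) : option intpart).

Lemma intpartn_codeK : pcancel code decode.
Proof.
move=> la; rewrite /code /decode /insub_bseq.
have : psize la == n by case: la.
case: la => -[s /= ps] ss /= /eqP sn.
have /andP[_ s0] := ps.
have sz : (size (map (@inord n) s) <= n)%N.
  rewrite size_map -sn /psize /= => {ss sn ps}; elim: s s0 => //= x s IH.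
  rewrite inE negb_or eq_sym -lt0n => /andP[x0 /IH sz].
  by rewrite -add1n leq_add.
rewrite insubdK //.
have -> : map val (map (@inord n) s) = s.
  rewrite -map_comp -[RHS]map_id; apply/eq_in_map => x xs /=.
  rewrite inordK // ltnS -sn /psize /= => {sz sn ss ps s0}.
  elim: s xs => //= y s IH; rewrite inE => /orP[/eqP ->|/IH xs].
    exact: leq_addr.
  exact: leq_trans xs (leq_addl _ _).
by rewrite (insubT is_part ps) /= insubT; congr Some; apply/val_inj/val_inj.
Qed.

End IntPartnFinite.

HB.instance Definition _ n : isFinite (intpartn n) :=
  PCanIsFinite (@intpartn_codeK n).

(* [pad la n] is the partition la[n] of n, or [None] if it is undefined.  The
   first part n - |la| can only vanish when la is empty and n = 0, where la[n]
   is the empty partition of 0. *)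
Definition pad_seq (la : intpart) (n : nat) : seq nat :=
  if n is 0 then la else (n - psize la)%N :: la.

Definition pad (la : intpart) (n : nat) : option (intpartn n) :=
  if (psize la + head 0%N la <= n)%N
  then obind insub (insub (pad_seq la n) : option intpart) else None.

Lemma padE (la : intpart) (n : nat) :
  (psize la + head 0%N la <= n)%N ->
  exists2 mu, pad la n = Some mu & parts mu = pad_seq la n.
Proof.
rewrite /pad => le; rewrite le.
have pos : (0 < n)%N -> (0 < n - psize la)%N.
  have /andP[_] : is_part la by case: (la).
  move: le; rewrite /psize; case: (parts la) => [|x s] le; first by rewrite subn0.
  rewrite inE negb_or eq_sym -lt0n => /andP[x0 _] _.
  rewrite subn_gt0; apply: leq_trans le.
  by rewrite -[X in (X < _)%N]addn0 ltn_add2l.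
have lela : (psize la <= n)%N by apply: leq_trans le; apply: leq_addr.
have pp : is_part (pad_seq la n).
  rewrite /pad_seq; case: n le pos {lela} => [|n] le pos; first by case: (la).
  have /andP[so s0] : is_part la by case: (la).
  move: (pos isT); rewrite lt0n => n0.
  rewrite /is_part inE negb_or eq_sym n0 s0 andbT /=.
  move: so le; rewrite /psize; case: (parts la) => [|x s] //= so le.
  by rewrite so andbT leq_subRL ?le // (leq_trans (leq_addr _ _) le).
have pn : sumn (pad_seq la n) == n.
  rewrite /pad_seq; case: n lela {le pos pp} => [|n] lela /=.
    by rewrite -leqn0.
  by rewrite subnK.
rewrite (insubT is_part pp) /= insubT.
by eexists; first by [].
Qed.

(* A symmetric function is represented, as an element of the inverse limit of
   the rings of symmetric polynomials, by its images in N variables for all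
   N. *)
Definition symfam (R : realType) : Type := forall N, {mpoly R[i][N]}.

Definition drop_last_var (R : realType) (N : nat) (p : {mpoly R[i][N.+1]}) :
    {mpoly R[i][N]} :=
  p \mPo [tuple if (unlift ord_max i : option 'I_N) is Some j then 'X_j else 0
            | i < N.+1].

Definition Lambda (R : realType) (n : nat) : set (symfam R) :=
  [set f : symfam R | forall N,
     [/\ f N \is symmetric, f N \is n.-homog
       & drop_last_var (f N.+1) = f N]]%classic.

Definition monomial (R : realType) (la : intpart) : symfam R := fun N =>
  \sum_(m : 'X_{1..N < (psize la).+1}
        | perm_eq [seq k <- (m : 'X_{1..N}) | k != 0%N] la) 'X_[m].

Definition complete1 (R : realType) (k : nat) : symfam R := fun N =>
  \sum_(m : 'X_{1..N < k.+1} | mdeg m == k) 'X_[m].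

Definition complete (R : realType) (la : intpart) : symfam R := fun N =>
  \prod_(k <- parts la) complete1 R k N.

Definition powersum (R : realType) (la : intpart) : symfam R := fun N =>
  \prod_(k <- parts la) \sum_(i < N) 'X_i ^+ k.

Definition zee (la : intpart) : nat :=
  \prod_(1 <= j < (psize la).+1) (j ^ count_mem j la * (count_mem j la)`!)%N.

Definition powersumz (R : realType) (la : intpart) : symfam R := fun N =>
  (zee la)%:R^-1 *: powersum R la N.

(* Schur polynomials are the bialternants a_(la + delta) / a_delta, with
   delta = (N-1, ..., 1, 0), and vanish in fewer than l(la) variables. *)
Definition alternant (R : realType) (N : nat) (s : seq nat) : {mpoly R[i][N]} :=
  \det (\matrix_(i < N, j < N) 'X_i ^+ (nth 0%N s j + (N - j.+1))).

Definition schur (R : realType) (la : intpart) : symfam R := fun N =>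
  if (size la <= N)%N then
    xget 0 [set q | q * alternant R N [::] = alternant R N la]%classic
  else 0.

Definition expansion (R : realType) (n : nat) (f : intpart -> symfam R)
    (G : symfam R) (c : {ffun intpartn n -> R[i]}) : Prop :=
  forall N, G N = \sum_(mu : intpartn n) c mu *: f mu N.

(* The coordinates of G in the basis (f mu) of the degree n part, mu ranging
   over the partitions of n. *)
Definition coord (R : realType) (n : nat) (f : intpart -> symfam R)
    (G : symfam R) : {ffun intpartn n -> R[i]} :=
  xget 0 [set c | expansion f G c]%classic.

(* [stab_index u] is the smallest n from which the sequence u is constant, with
   [None] standing for infinity. *)
Definition stab_index (T : Type) (u : nat -> T) : option nat :=
  match pselect (exists n, `[< forall k, u n = u (n + k)%N >]) with
  | left ex => Some (ex_minn ex)
  | right _ => None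
  end.

Definition index_le (x : option nat) (b : nat) : bool :=
  if x is Some n then (n <= b)%N else false.

Definition padded_coef (R : realType) (f : intpart -> symfam R)
    (F : nat -> symfam R) (la : intpart) (n : nat) : R[i] :=
  if pad la n is Some mu then coord n f (F n) mu else 0.

Definition rg (R : realType) (f : intpart -> symfam R) (F : nat -> symfam R)
    (la : intpart) : option nat :=
  stab_index (padded_coef f F la).

Definition stable (R : realType) (f : intpart -> symfam R)
    (F : nat -> symfam R) : Prop :=
  forall la, rg f F la <> None.

Definition unif_stable (R : realType) (f : intpart -> symfam R)
    (F : nat -> symfam R) : Prop :=
  exists b, forall la, index_le (rg f F la) b.

Definition trans_coef (R : realType) (f g : intpart -> symfam R)
    (la mu : intpart) (n : nat) : R[i] :=
  match pad la n, pad mu n with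
  | Some la', Some mu' => coord n g (f la') mu'
  | _, _ => 0
  end.

Definition Nindex (R : realType) (f g : intpart -> symfam R)
    (la mu : intpart) : option nat :=
  stab_index (trans_coef f g la mu).

Definition Jset (R : realType) (f g : intpart -> symfam R) (mu : intpart) :
    set intpart :=
  [set la | exists n, trans_coef f g la mu n != 0]%classic.

Definition Iset (R : realType) (f g : intpart -> symfam R) (la : intpart) :
    set intpart :=
  [set mu | exists n, trans_coef f g la mu n != 0]%classic.

(* Main.v *)
Require Import Defs.
From mathcomp Require Import all_boot all_algebra.
From mathcomp Require Import classical_sets reals.
From mathcomp Require Import all_fingroup boolp complex mpoly zify ring.

Set Implicit Arguments.
Unset Strict Implicit.
Unset Printing Implicit Defensive.

Import GRing.Theory Num.Theory.

Local Open Scope ring_scope.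

(** Every comparison reduces to one of two families of matrices indexed by the
    partitions of [n], each used twice, as it stands and transposed:
    - the inverse Kostka matrix IK ([schur_coef]), which gives m = IK s, hence
      s = IK^-1 m, and, by the Jacobi-Trudi identity, s = IK^T h, hence
      h = (IK^-1)^T s;
    - the matrix Q of the coefficients of x^la in p_mu ([power_coef]), which gives
      p = Q^T m, hence m = (Q^-1)^T p, and, by the Cauchy identity,
      h = Q (p/z), hence p/z = Q^-1 h.

    Both matrices are triangular for the dominance order with nonzero diagonal,
    so they are invertible, with inverses triangular in the same sense
    ([dominance_inverse]).  Dominance compares first parts, and the first part
    of la[n] is n - |la|: a nonzero entry at (la[n], mu[n]) forces
    |la| <= |mu|.  This is the description of the sets J and, after
    transposition, of the sets I.

    The entry at (la[n], mu[n]) does not depend on n once n is at least 2|mu|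
    for the first matrix, and greater than 2|mu| for the second, because the
    first part of mu[n] is then so large that it can only interact with the
    first part of la[n] ([schur_coef_stable], [power_coef_stable]).  The entries
    with tails of size at most k form a diagonal block whose inverse is the
    corresponding block of the inverse matrix, so the inverse matrices stabilise
    at the same rank ([inverse_pad_stable]).

    Changing basis along a matrix of this kind expresses each new coefficient
    through the finitely many old ones with |la| <= |mu|, which preserves
    stability ([stable_expands]).  Along a transposed matrix, each old basis
    element contributes to tails no larger than its own.  Uniform stability
    means that from some rank on only finitely many tails occur, with constant
    coefficients, so it is preserved ([unif_stable_expands]). *)

(** * Partitions and dominance *)

Definition dominated (mu la : seq nat) : Prop :=
  forall k, (sumn (take k mu) <= sumn (take k la))%N.

(** Induction on [s]: a sub-multiset that misses the largest entry of [s] only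
    gains by exchanging one of its entries for it. *)
Lemma sumn_take_sorted (s t r : seq nat) :
  sorted geq s -> perm_eq (t ++ r) s -> (sumn t <= sumn (take (size t) s))%N.
Proof.
elim: s t r => [|x s IH] [|y t] r // ss ptr.
  by move/perm_size: ptr; rewrite /= size_cat.
have sx : sorted geq s by apply: path_sorted ss.
have [xt|xt] := boolP (x \in y :: t).
  have pt := perm_to_rem xt.
  have ->: sumn (y :: t) = (x + sumn (rem x (y :: t)))%N by rewrite (perm_sumn pt).
  have -> : size (y :: t) = (size (rem x (y :: t))).+1 by rewrite (perm_size pt).
  rewrite /= leq_add2l; apply: (IH _ r) => //.
  rewrite -(perm_cons x); apply: perm_trans ptr.
  by rewrite -cat_cons perm_cat2r perm_sym.
have xr : x \in r.
  by move: (perm_mem ptr x); rewrite mem_cat (negPf xt) inE eqxx.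
have yx : (y <= x)%N.
  have : y \in x :: s by rewrite -(perm_mem ptr) mem_cat mem_head.
  rewrite inE => /orP[/eqP->//|ys].
  have gt : transitive geq by move=> a b c ab bc; apply: leq_trans bc ab.
  by move: ss => /= /(order_path_min gt) /allP /(_ _ ys).
rewrite /=; apply: leq_add => //; apply: (IH _ (y :: rem x r)) => //.
rewrite -(perm_cons x); apply: perm_trans ptr.
have -> : x :: t ++ y :: rem x r = ((x :: t) ++ [:: y]) ++ rem x r.
  by rewrite -catA.
have -> : (y :: t) ++ r = [:: y] ++ t ++ r by [].
apply: (@perm_trans _ ([:: y] ++ (x :: t) ++ rem x r)).
  by rewrite catA perm_cat2r perm_catC.
rewrite perm_cat2l perm_sym.
apply: (@perm_trans _ (t ++ x :: rem x r)); first by rewrite perm_cat2l perm_to_rem.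
by rewrite -cat1s perm_catCA.
Qed.

Lemma partsP (la : intpart) : is_part la.
Proof. by case: la. Qed.

Lemma parts_sorted (la : intpart) : sorted geq la.
Proof. by case/andP: (partsP la). Qed.

Lemma parts_gt0 (la : intpart) : 0%N \notin parts la.
Proof. by case/andP: (partsP la). Qed.

Lemma geq_trans : transitive geq.
Proof. by move=> a b c ab bc; apply: leq_trans bc ab. Qed.

Lemma geq_total : total geq.
Proof. by move=> a b; apply: leq_total. Qed.

Lemma geq_anti : antisymmetric geq.
Proof. by move=> a b; rewrite andbC; apply: anti_leq. Qed.

Lemma parts_perm_inj (la mu : intpart) : perm_eq la mu -> la = mu.
Proof.
move=> /(sorted_eq geq_trans geq_anti (parts_sorted la) (parts_sorted mu)) E.
exact/val_inj.
Qed.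

Lemma sumn_filter0 (s : seq nat) : sumn [seq k <- s | k != 0%N] = sumn s.
Proof. by elim: s => //= -[|x] s /= ->. Qed.

Lemma filter0_sort_is_part (s : seq nat) :
  is_part (sort geq [seq k <- s | k != 0%N]).
Proof.
by rewrite /is_part sort_sorted /= ?mem_sort ?mem_filter //; apply: geq_total.
Qed.

(** Recording the shape of an exponent vector as a partition turns conditions
    up to rearrangement into equalities. *)
Definition part_of (s : seq nat) : intpart := IntPart (filter0_sort_is_part s).

Arguments part_of : simpl never.

Lemma part_ofP (s : seq nat) : perm_eq [seq k <- s | k != 0%N] (part_of s).
Proof. by rewrite perm_sym perm_sort. Qed.

Lemma psize_part_of (s : seq nat) : psize (part_of s) = sumn s.
Proof. by rewrite /psize -(perm_sumn (part_ofP s)) sumn_filter0. Qed.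

Lemma perm_part_of (s : seq nat) (la : intpart) :
  perm_eq [seq k <- s | k != 0%N] la = (part_of s == la).
Proof.
apply/idP/eqP => [p|<-]; last exact: part_ofP.
by apply/parts_perm_inj/(perm_trans _ p); rewrite perm_sym part_ofP.
Qed.

Lemma part_of_id (la : intpart) : part_of la = la.
Proof.
apply/eqP; rewrite -perm_part_of (all_filterP _) //.
by apply/allP => x xl; apply: contraNneq (parts_gt0 la) => <-.
Qed.

Lemma leq_size_sumn (s : seq nat) : 0%N \notin s -> (size s <= sumn s)%N.
Proof. by elim: s => //= -[|x] s IH; rewrite inE //= => /IH; lia. Qed.

Lemma size_le_psize (la : intpart) : (size la <= psize la)%N.
Proof. exact/leq_size_sumn/parts_gt0. Qed.

Lemma head_le_psize (la : intpart) : (head 0%N la <= psize la)%N.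
Proof. by rewrite /psize; case: (parts la) => //= x s; rewrite leq_addr. Qed.

Lemma nth_le_psize (la : intpart) i : (nth 0%N la i <= psize la)%N.
Proof.
rewrite /psize; elim: (parts la) i => [|x s IH] [|i] //=; first exact: leq_addr.
exact: leq_trans (IH i) (leq_addl _ _).
Qed.

Lemma psizeE n (a : intpartn n) : psize a = n.
Proof. by case: a => a /= /eqP. Qed.

Lemma dominated_trans s t u : dominated s t -> dominated t u -> dominated s u.
Proof. by move=> st tu k; apply: leq_trans (st k) (tu k). Qed.

Lemma sumn_takeS (s : seq nat) k :
  sumn (take k.+1 s) = (sumn (take k s) + nth 0%N s k)%N.
Proof.
have [ks|sk] := ltnP k (size s); first by rewrite (take_nth 0%N ks) sumn_rcons.
by rewrite (nth_default _ sk) addn0 !take_oversize // leqW.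
Qed.

Lemma dominated_anti (la mu : intpart) :
  dominated la mu -> dominated mu la -> la = mu.
Proof.
move=> lm ml.
have E k : sumn (take k la) = sumn (take k mu).
  by apply/eqP; rewrite eqn_leq lm ml.
have {}E k : nth 0%N la k = nth 0%N mu k.
  by apply/eqP; rewrite -(eqn_add2l (sumn (take k la))) {2}E -!sumn_takeS E.
have H (u v : intpart) : (forall k, nth 0%N u k = nth 0%N v k) ->
    (size u <= size v)%N.
  move=> uv; rewrite leqNgt; apply/negP => lt.
  have := parts_gt0 u; rewrite -(nth_default 0%N (leqnn (size v))) -uv.
  by rewrite mem_nth.
apply/val_inj; apply: (@eq_from_nth _ 0%N) => [|i _]; last exact: E.
by apply/eqP; rewrite eqn_leq !H.
Qed.

Lemma dominated_head s t : dominated s t -> (head 0%N s <= head 0%N t)%N.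
Proof. by move=> /(_ 1%N); case: s t => [|x s] [|y t] //=; rewrite ?take0 ?addn0. Qed.

Lemma pad_seq0 (la : intpart) n :
  (psize la <= n)%N -> nth 0%N (pad_seq la n) 0 = (n - psize la)%N.
Proof.
case: n => //=; rewrite leqn0 => /eqP h; rewrite h.
by have := nth_le_psize la 0; rewrite h leqn0 => /eqP.
Qed.

Lemma pad_seqS (la : intpart) n i :
  (psize la <= n)%N -> nth 0%N (pad_seq la n) i.+1 = nth 0%N la i.
Proof.
case: n => //=; rewrite leqn0 => /eqP h.
by have := nth_le_psize la i; have := nth_le_psize la i.+1; rewrite h; lia.
Qed.

Lemma padP (la : intpart) n : (psize la + head 0%N la <= n)%N ->
  {a : intpartn n | pad la n = Some a & parts a = pad_seq la n}.
Proof.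
move=> h; case E : (pad la n) => [a|].
  by exists a => //; have [b] := padE h; rewrite E => -[->].
by exfalso; have [b] := padE h; rewrite E.
Qed.

Lemma pad_Some (la : intpart) n a : pad la n = Some a ->
  (psize la + head 0%N la <= n)%N /\ parts a = pad_seq la n.
Proof.
move=> E; have h : (psize la + head 0%N la <= n)%N.
  by move: E; rewrite /pad; case: ifP.
by split=> //; have [b] := padE h; rewrite E => -[->].
Qed.

(** Every partition of [n] is the padding of its tail, so that indices that
    depend on [n] can be replaced by tails, which make sense for all [n]. *)
Lemma pad_behead n (a : intpartn n) :
  pad (part_of (behead a)) n = Some a.
Proof.
have E : parts (part_of (behead a)) = behead a.
  have -> : parts (part_of (behead a)) = sort geq (behead a).
    congr (sort _ _); apply/all_filterP/allP => x xa.
    by apply: contraNneq (parts_gt0 a) => <-; apply: mem_behead.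
  apply: (sorted_sort geq_trans).
  by case: (parts a) (parts_sorted a) => //= x s; apply: path_sorted.
have pa := psizeE a.
have h : (psize (part_of (behead a)) + head 0%N (part_of (behead a)) <= n)%N.
  rewrite psize_part_of E -[X in (_ <= X)%N]pa /psize.
  case: (parts a) (parts_sorted a) => //= x s.
  by case: s => [|y s] //= /andP[yx _]; rewrite addnC leq_add2r.
case: (padP h) => b -> Eb; congr Some; apply/val_inj/val_inj => /=.
rewrite Eb; move: (psize_part_of (behead a)).
rewrite /pad_seq; case: n a pa {h b Eb} E => [|n] a pa E h.
  rewrite E; have := size_le_psize a; rewrite pa leqn0 size_eq0.
  by move/eqP => ->.
rewrite h E; move: pa; rewrite /psize; case: (parts a) => //= x s <-.
by rewrite addnK.
Qed.

Lemma pad_inj (la mu : intpart) n a :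
  pad la n = Some a -> pad mu n = Some a -> la = mu.
Proof.
move=> /pad_Some[hl El] /pad_Some[hm]; rewrite El.
case: n a El hl hm => [|n] a El hl hm /=; first by move/val_inj.
by case=> _ /val_inj.
Qed.

(** * The monomial basis *)

Definition mnm_of (N : nat) (la : seq nat) : 'X_{1..N} :=
  [multinom nth 0%N la i | i < N].

Local Notation "m # s" := [multinom (m : 'X_{1.._}) (s i) | i < _]
  (at level 40, left associativity).

Lemma mdeg_sumn N (v : 'X_{1..N}) : mdeg v = sumn v.
Proof. by rewrite sumnE. Qed.

Lemma psize_part_of_mnm N (v : 'X_{1..N}) : psize (part_of v) = mdeg v.
Proof. by rewrite psize_part_of mdeg_sumn. Qed.

Lemma mnm_seqE N (v : 'X_{1..N}) : v = [seq v i | i <- enum 'I_N] :> seq nat.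
Proof.
apply: (@eq_from_nth _ 0%N) => [|i]; first by rewrite size_map -cardE card_ord size_tuple.
rewrite size_tuple => iN; rewrite (nth_map (Ordinal iN)) -?cardE ?card_ord //.
by rewrite (mnm_nth 0%N) nth_enum_ord.
Qed.

Lemma perm_mnm N (v w : 'X_{1..N}) : perm_eq v w -> exists s : 'S_N, v = w # s.
Proof.
case/tuple_permP => s vs; exists s; apply/mnmP => i.
by rewrite mnmE (mnm_nth 0%N) vs -tnth_nth tnth_mktuple.
Qed.

Lemma mnm_perm N (w : 'X_{1..N}) (s : 'S_N) : perm_eq (w # s) w.
Proof.
by apply/tuple_permP; exists s; congr (tval _); apply/eq_from_tnth => i;
  rewrite !tnth_mktuple.
Qed.

Lemma part_of_perm s t : perm_eq s t -> part_of s = part_of t.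
Proof.
move=> st; apply/eqP; rewrite -perm_part_of.
by apply: perm_trans (part_ofP t); apply: perm_filter.
Qed.

Lemma mnm_of_seq N (la : seq nat) :
  (size la <= N)%N -> mnm_of N la = la ++ nseq (N - size la) 0%N :> seq nat.
Proof.
move=> sN; apply: (@eq_from_nth _ 0%N).
  by rewrite size_tuple size_cat size_nseq subnKC.
move=> i; rewrite size_tuple => iN; rewrite -(mnm_nth 0%N _ (Ordinal iN)) mnmE /=.
rewrite nth_cat nth_nseq; case: ltnP => // /(nth_default 0%N) ->.
by case: ifP.
Qed.

Lemma part_of_mnm_of N (la : intpart) :
  (size la <= N)%N -> part_of (mnm_of N la) = la.
Proof.
move=> sN; apply/eqP; rewrite -perm_part_of mnm_of_seq // filter_cat.
have -> : [seq k <- nseq (N - size la) 0%N | k != 0%N] = [::].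
  by elim: (N - size la)%N.
by rewrite cats0 perm_part_of part_of_id.
Qed.

Lemma mdeg_mnm_of N (la : intpart) :
  (size la <= N)%N -> mdeg (mnm_of N la) = psize la.
Proof. by move=> sN; rewrite -psize_part_of_mnm part_of_mnm_of. Qed.

Lemma size_part_of_mnm N (v : 'X_{1..N}) : (size (part_of v) <= N)%N.
Proof.
rewrite -(perm_size (part_ofP v)) size_filter.
by rewrite -[X in (_ <= X)%N](size_tuple v) count_size.
Qed.

Lemma perm_pad_zeros (s la : seq nat) :
  perm_eq [seq k <- s | k != 0%N] la ->
  perm_eq s (la ++ nseq (size s - size la) 0%N).
Proof.
move=> p; rewrite -(perm_size p) size_filter.
have -> : (size s - count (fun k => k != 0%N) s)%N = count_mem 0%N s.
  by rewrite -(count_predC (fun k => k != 0%N) s) addKn; apply: eq_count => -[].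
have -> : nseq (count_mem 0%N s) 0%N = [seq k <- s | predC (fun k => k != 0%N) k].
  by elim: s {p} => //= -[|x] s IH; rewrite ?add0n ?add1n /= IH.
apply: (@perm_trans _ ([seq k <- s | k != 0%N] ++
  [seq k <- s | predC (fun k => k != 0%N) k])); last by rewrite perm_cat2r.
by rewrite perm_sym; apply/permPl/perm_filterC.
Qed.

Lemma mnm_sort N (v : 'X_{1..N}) :
  exists s : 'S_N, v = mnm_of N (part_of v) # s.
Proof.
apply: perm_mnm; rewrite mnm_of_seq ?size_part_of_mnm //.
by have := perm_pad_zeros (part_ofP v); rewrite size_tuple.
Qed.

Lemma widen_lift_max N (j : 'I_N) : widen_ord (leqnSn N) j = lift ord_max j.
Proof. by apply/val_inj; rewrite /= /bump leqNgt ltn_ord. Qed.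

Section MonomialBasis.
Variable R : realType.
Local Notation C := R[i].

Lemma mcoeff_monomial (la : intpart) N (v : 'X_{1..N}) :
  (monomial R la N)@_v = (part_of v == la)%:R.
Proof.
rewrite /monomial raddf_sum /=.
under eq_bigr => m _ do rewrite mcoeffX.
have [E|E] := eqVneq (part_of v) la; last first.
  rewrite big1 // => m; rewrite perm_part_of => /eqP ml.
  by case: eqP => // mv; rewrite -mv ml eqxx in E.
have lt : (mdeg v < (psize la).+1)%N by rewrite -E psize_part_of_mnm.
rewrite (bigD1 (BMultinom lt)) /= ?perm_part_of ?E // eqxx big1 ?addr0 //.
by move=> m /andP[_ nm]; case: eqP => // mv; case/eqP: nm; apply/val_inj.
Qed.

Lemma sym_mcoeff N (p : {mpoly C[N]}) v :
  p \is symmetric -> p@_v = p@_(mnm_of N (part_of v)).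
Proof. by move=> sp; have [s {1}->] := mnm_sort v; rewrite msym_coeff. Qed.

(** Setting the last variable to zero kills the monomials that involve it and
    leaves the others unchanged. *)
Lemma mcoeff_drop_last N (p : {mpoly C[N.+1]}) (v : 'X_{1..N}) :
  (drop_last_var p)@_v = p@_(mnmwiden v).
Proof.
rewrite /drop_last_var comp_mpolyEX [in RHS](mpolyE p) !raddf_sum /=.
apply: eq_bigr => m _; rewrite !mcoeffZ comp_mpolyX mcoeffX.
congr (_ * _); rewrite big_ord_recr /= tnth_mktuple unlift_none.
have -> : \prod_(i < N) (tnth [tuple if (unlift ord_max i : option 'I_N) is Some j
    then 'X_j else 0 | i < N.+1] (widen_ord (leqnSn N) i)) ^+ m (widen_ord (leqnSn N) i)
    = 'X_[ [multinom m (widen_ord (leqnSn N) i) | i < N] ] :> {mpoly C[N]}.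
  rewrite [RHS]mpolyXE_id; apply: eq_bigr => i _; rewrite tnth_mktuple mnmE.
  by rewrite widen_lift_max liftK.
rewrite expr0n; have [m0|m0] := eqVneq (m ord_max) 0%N; last first.
  rewrite mulr0 mcoeff0; case: eqP => // mE.
  by rewrite mE mnmwiden_ordmax in m0.
rewrite mulr1 mcoeffX; congr (_%:R); congr nat_of_bool.
apply/eqP/eqP => [<-|->]; last first.
  by apply/mnmP => i; rewrite mnmE mnmwiden_widen.
apply/mnmP => i; have [j ->|->] := unliftP ord_max i; last first.
  by rewrite mnmwiden_ordmax.
by rewrite -widen_lift_max mnmwiden_widen mnmE.
Qed.

Lemma mnmwiden_seq N (v : 'X_{1..N}) : mnmwiden v = rcons v 0%N :> seq nat.
Proof. by []. Qed.

Lemma part_of_mnmwiden N (v : 'X_{1..N}) : part_of (mnmwiden v) = part_of v.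
Proof.
apply/eqP; rewrite -perm_part_of mnmwiden_seq filter_rcons /=.
exact: part_ofP.
Qed.

Lemma mnmwiden_mnm_of N (la : seq nat) :
  (size la <= N)%N -> mnmwiden (mnm_of N la) = mnm_of N.+1 la.
Proof.
move=> sN; apply/mnmP => i; have [j ->|->] := unliftP ord_max i; last first.
  by rewrite mnmwiden_ordmax mnmE /= nth_default.
by rewrite -widen_lift_max mnmwiden_widen !mnmE.
Qed.

Lemma symmetric_mpoly N (p : {mpoly C[N]}) :
  (forall v w : 'X_{1..N}, part_of v = part_of w -> p@_v = p@_w) -> p \is symmetric.
Proof.
move=> H; apply/issymP => s; apply/mpolyP => v; rewrite mcoeff_sym.
exact/H/part_of_perm/mnm_perm.
Qed.

Lemma Lambda_monomial (la : intpart) : Lambda (psize la) (monomial R la).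
Proof.
move=> N; split.
- by apply: symmetric_mpoly => v w vw; rewrite !mcoeff_monomial vw.
- apply/dhomogP => v; rewrite mcoeff_msupp mcoeff_monomial.
  case: (part_of v =P la) => [<- _|];
    by rewrite ?psize_part_of_mnm ?eqxx.
- by apply/mpolyP => v; rewrite mcoeff_drop_last !mcoeff_monomial part_of_mnmwiden.
Qed.

Lemma Lambda_sum (I : finType) n (c : I -> C) (f : I -> symfam R) :
  (forall i, Lambda n (f i)) -> Lambda n (fun N => \sum_i c i *: f i N).
Proof.
move=> H N; split.
- by apply: rpred_sum => i _; apply: rpredZ; case: (H i N).
- by apply: rpred_sum => i _; apply: dhomogZ; case: (H i N).
- rewrite /drop_last_var raddf_sum /=; apply: eq_bigr => i _.
  by rewrite linearZ /=; congr (_ *: _); case: (H i N).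
Qed.

(** Monomials without the last variable keep their coefficient when it is set
    to zero; this makes the coefficient at a partition an invariant of [G]. *)
Lemma Lambda_mcoeff n (G : symfam R) (la : intpart) N M :
  Lambda n G -> (size la <= N)%N -> (N <= M)%N ->
  (G N)@_(mnm_of N la) = (G M)@_(mnm_of M la).
Proof.
move=> LG sN /subnKC <-; elim: (M - N)%N => [|k IH]; first by rewrite addn0.
rewrite {}IH addnS; have [_ _ <-] := LG (N + k)%N.
by rewrite mcoeff_drop_last mnmwiden_mnm_of // (leq_trans sN) ?leq_addr.
Qed.

Definition mon_coef n (G : symfam R) (la : intpart) : C := (G n)@_(mnm_of n la).

Lemma Lambda_mpoly_eq n (G : symfam R) N (v : 'X_{1..N}) :
  Lambda n G -> (G N)@_v = if mdeg v == n then mon_coef n G (part_of v) else 0.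
Proof.
move=> LG; have [sG hG _] := LG N; case: eqP => [vn|/eqP vn]; last first.
  exact: dhomog_nemf_coeff vn.
rewrite sym_mcoeff // /mon_coef.
have sn : (size (part_of v) <= n)%N.
  by rewrite -vn -psize_part_of_mnm size_le_psize.
have sN := size_part_of_mnm v.
by case/orP: (leq_total N n) => h; [|apply/esym]; apply: (Lambda_mcoeff LG).
Qed.

Lemma Lambda_monomial_n n (a : intpartn n) : Lambda n (monomial R a).
Proof. by rewrite -[X in Lambda X](psizeE a); apply: Lambda_monomial. Qed.

Lemma intpartn_of n (la : intpart) : psize la = n -> {a : intpartn n | a = la :> intpart}.
Proof. by move=> /eqP E; exists (IntPartn E). Qed.

Lemma mcoeff_monomial_sum n (c : intpartn n -> C) N (v : 'X_{1..N}) (a : intpartn n) :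
  part_of v = a -> (\sum_b c b *: monomial R b N)@_v = c a.
Proof.
move=> va; rewrite raddf_sum (bigD1 a) //= mcoeffZ mcoeff_monomial va eqxx mulr1.
rewrite big1 ?addr0 // => b ba; rewrite mcoeffZ mcoeff_monomial va.
by case: eqP => [E|_]; rewrite ?mulr0 //; case/eqP: ba; apply/val_inj.
Qed.

Lemma Lambda_expansion n (G : symfam R) : Lambda n G ->
  expansion (monomial R) G [ffun a : intpartn n => mon_coef n G a].
Proof.
move=> LG N; apply/mpolyP => v; rewrite (Lambda_mpoly_eq _ LG).
have [vn|vn] := eqVneq (mdeg v) n.
  have [a Ea] : {a : intpartn n | a = part_of v :> intpart}.
    by apply: intpartn_of; rewrite psize_part_of_mnm.
  by rewrite (mcoeff_monomial_sum _ (a := a)) ?ffunE ?Ea.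
rewrite raddf_sum big1 //= => a _; rewrite mcoeffZ mcoeff_monomial.
case: eqP => [E|]; rewrite ?mulr0 //; case/eqP: vn.
by rewrite -psize_part_of_mnm E psizeE.
Qed.

Lemma monomial_free n (G : symfam R) (c d : {ffun intpartn n -> C}) :
  expansion (monomial R) G c -> expansion (monomial R) G d -> c = d.
Proof.
move=> Gc Gd; apply/ffunP => a; have := etrans (esym (Gc n)) (Gd n).
have pa : part_of (mnm_of n a) = a.
  by rewrite part_of_mnm_of // -[X in (_ <= X)%N](psizeE a) size_le_psize.
by move/(congr1 (mcoeff (mnm_of n a))); rewrite !(mcoeff_monomial_sum _ (a := a)).
Qed.

(** In at least [n] variables every partition of [n] is the shape of a
    monomial, so no information on a symmetric function of degree [n] is lost. *)
Lemma Lambda_inj n (F G : symfam R) N : Lambda n F -> Lambda n G ->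
  (n <= N)%N -> F N = G N -> forall M, F M = G M.
Proof.
move=> LF LG nN FG M; apply/mpolyP => v.
rewrite (Lambda_mpoly_eq _ LF) (Lambda_mpoly_eq _ LG); case: eqP => // vn.
have sn : (size (part_of v) <= n)%N.
  by rewrite -vn -psize_part_of_mnm size_le_psize.
by rewrite /mon_coef (Lambda_mcoeff LF sn nN) (Lambda_mcoeff LG sn nN) FG.
Qed.

End MonomialBasis.

(** * Families of matrices indexed by partitions *)

(** Elimination along a partial order.  The row [a] of the inverse is obtained
    by induction from [X a a e_a = X_a - sum_(c < a) X a c e_c], where [X_a] is
    the row [a] of [X]; this also shows that it is supported below [a]. *)
Lemma triangular_inverse (C : fieldType) (I : finType) (le : rel I)
    (X : I -> I -> C) :
  transitive le -> antisymmetric le ->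
  (forall a b, X a b != 0 -> le b a) -> (forall a, X a a != 0) ->
  exists Y : I -> I -> C,
    [/\ forall a b, Y a b != 0 -> le b a,
        forall a b, \sum_c Y a c * X c b = (a == b)%:R
      & forall a b, \sum_c X a c * Y c b = (a == b)%:R].
Proof.
move=> tr anti XL Xd.
have rows a : exists y : {ffun I -> C}, (forall b, y b != 0 -> le b a) /\
    (forall b, \sum_c y c * X c b = (a == b)%:R).
  have [k] := ubnP #|[pred c | le c a && (c != a)]|.
  elim: k a => // k IH a /ltnSE ak.
  have below c : exists y : {ffun I -> C}, le c a && (c != a) ->
      (forall b, y b != 0 -> le b c) /\
      (forall b, \sum_d y d * X d b = (c == b)%:R).
    have [/andP[ca nca]|] := boolP (le c a && (c != a)); last by exists [ffun=> 0].
    have [|y yP] := IH c; last by exists y.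
    apply: leq_trans ak; apply: proper_card; apply/properP; split.
      apply/fintype.subsetP => d; rewrite !inE => /andP[dc ndc].
      rewrite (tr _ _ _ dc ca) /=; apply: contraNneq nca => da.
      by apply/eqP/anti; rewrite ca -da dc.
    by exists c; rewrite !inE ?ca ?nca // eqxx andbF.
  have [y yP] := fin_all_exists below.
  have aa : le a a by apply: XL; apply: Xd.
  exists [ffun b => (X a a)^-1 *
    ((a == b)%:R - \sum_(c | le c a && (c != a)) X a c * y c b)]; split=> b.
    rewrite ffunE; apply: contraNT => nba.
    have nab : a != b by apply: contraNneq nba => <-.
    rewrite (negPf nab) sub0r big1 ?oppr0 ?mulr0 // => c ca.
    have [yL _] := yP c ca; case: (eqVneq (y c b) 0) => [->|/yL bc]; rewrite ?mulr0 //.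
    by case/andP: ca => ca _; rewrite (tr _ _ _ bc ca) in nba.
  under eq_bigr => c _ do rewrite ffunE -mulrA mulrBl.
  rewrite -mulr_sumr sumrB.
  have -> : \sum_i (a == i)%:R * X i b = X a b.
    rewrite (bigD1 a) //= eqxx mul1r big1 ?addr0 // => c /negPf.
    by rewrite eq_sym => ->; rewrite mul0r.
  have -> : \sum_i (\sum_(c | le c a && (c != a)) X a c * y c i) * X i b
      = \sum_(c | le c a && (c != a)) X a c * (c == b)%:R.
    under eq_bigr => i _ do rewrite mulr_suml.
    rewrite exchange_big /=; apply: eq_bigr => c ca.
    have [_ <-] := yP c ca; rewrite mulr_sumr.
    by apply: eq_bigr => i _; rewrite mulrA.
  apply: (mulfI (Xd a)); rewrite mulVKf //.
  have [<-|nab] := eqVneq a b.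
    rewrite mulr1 big1 ?subr0 // => c /andP[_ /negPf ->]; exact: mulr0.
  rewrite mulr0; have [ba|nba] := boolP (le b a).
    rewrite (bigD1 b) /= ?ba 1?eq_sym // eqxx mulr1 big1 ?addr0 ?subrr //.
    by move=> c /andP[_ /negPf ->]; rewrite mulr0.
  have -> : X a b = 0 by apply: contraNeq nba => /XL.
  rewrite big1 ?subrr // => c /andP[ca _]; case: eqP => [cb|]; rewrite ?mulr0 //.
  by rewrite cb (negPf nba) in ca.
have [Y YP] := fin_all_exists rows.
exists (fun a b => Y a b); split.
- by move=> a b; case: (YP a) => H _; apply: H.
- by move=> a b; case: (YP a) => _; apply.
(* A left inverse of a square matrix is also a right inverse. *)
pose mx (Z : I -> I -> C) := \matrix_(i < #|I|, j < #|I|) Z (enum_val i) (enum_val j).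
have mxM Z W i j : (mx Z *m mx W) i j = \sum_c Z (enum_val i) c * W c (enum_val j).
  rewrite mxE (reindex (@enum_val I I)) /=; last first.
    by apply: onW_bij; exact: enum_val_bij.
  by apply: eq_bigr => k _; rewrite !mxE.
have /mulmx1C XY1 : mx (fun a b => Y a b) *m mx X = 1%:M.
  apply/matrixP => i j; rewrite mxM mxE; case: (YP (enum_val i)) => _ ->.
  by rewrite (inj_eq enum_val_inj).
move=> a b; have := congr1 (fun Z : 'M_#|I| => Z (enum_rank a) (enum_rank b)) XY1.
by rewrite mxM mxE !enum_rankK (inj_eq enum_rank_inj).
Qed.

Definition parts_upto k : seq intpart :=
  undup (flatten [seq map (@intpartn_val i) (enum {: intpartn i}) | i <- iota 0 k.+1]).

Lemma mem_parts_upto k la : (la \in parts_upto k) = (psize la <= k)%N.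
Proof.
rewrite mem_undup; apply/flatten_mapP/idP => [ [d] | lak].
  by rewrite mem_iota => dk /mapP[a _ ->]; rewrite psizeE.
exists (psize la); first by rewrite mem_iota.
have [a Ea] := intpartn_of (erefl (psize la)).
by rewrite -[X in X \in _]Ea; apply: map_f; rewrite mem_enum.
Qed.

Lemma head_pad n (la : intpart) a : pad la n = Some a -> head 0%N a = (n - psize la)%N.
Proof.
case/pad_Some => h E; rewrite -nth0 E pad_seq0 //.
exact: leq_trans (leq_addr _ _) h.
Qed.

Lemma pad_psize n (la : intpart) a : pad la n = Some a -> (psize la <= n)%N.
Proof. by case/pad_Some => h _; exact: leq_trans (leq_addr _ _) h. Qed.

Lemma pad_defined (la : intpart) k n : (psize la <= k)%N -> (2 * k <= n)%N ->
  {a | pad la n = Some a}.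
Proof.
move=> lak kn; case: (@padP la n) => [|a]; last by exists a.
by have := head_le_psize la; lia.
Qed.

(** Padding is a bijection from the admissible tails to the partitions of [n];
    a bound on the tails that matter makes the range of summation independent
    of [n]. *)
Lemma sum_pad (C : nmodType) n k (F : intpartn n -> C) :
  (forall la a, pad la n = Some a -> F a != 0 -> (psize la <= k)%N) ->
  \sum_a F a = \sum_(la <- parts_upto k) oapp F 0 (pad la n).
Proof.
move=> Fk.
have -> : \sum_(la <- parts_upto k) oapp F 0 (pad la n)
    = \sum_(la <- parts_upto k) \sum_a (if pad la n == Some a then F a else 0).
  apply: eq_bigr => la _; case E: (pad la n) => [a|] /=.
    rewrite (bigD1 a) //= eqxx big1 ?addr0 // => b ba.
    by case: eqP => // -[ab]; rewrite ab eqxx in ba.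
  by rewrite big1.
rewrite exchange_big /=; apply: eq_bigr => a _.
have Ea := pad_behead a; set la := part_of _ in Ea.
have [Fa|Fa] := eqVneq (F a) 0.
  by rewrite Fa big1 // => mu _; case: ifP.
have lak : la \in parts_upto k by rewrite mem_parts_upto (Fk la a).
rewrite (bigD1_seq la) ?undup_uniq //= Ea eqxx big1 ?addr0 // => mu mula.
by case: eqP => // Em; rewrite (pad_inj Em Ea) eqxx in mula.
Qed.

Section PartitionMatrices.
Variable C : fieldType.

Definition pmat := forall n, intpartn n -> intpartn n -> C.
Implicit Types X Y : pmat.

Definition pad_entry X (la mu : intpart) n : C :=
  match pad la n, pad mu n with Some a, Some b => X n a b | _, _ => 0 end.

(** Between padded partitions, whose first parts are [n - |la|] and [n - |mu|],
    this says that a nonzero entry forces [|la| <= |mu|]. *)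
Definition head_lower X := forall n (a b : intpartn n),
  X n a b != 0 -> (head 0%N b <= head 0%N a)%N.

Definition pad_stable X e := forall la mu : intpart, (psize la <= psize mu)%N ->
  forall n, (2 * psize mu + e <= n)%N ->
  pad_entry X la mu n = pad_entry X la mu (2 * psize mu + e).

Definition inverses X Y := forall n (a b : intpartn n),
  \sum_c X n a c * Y n c b = (a == b)%:R.

(** The form in which the condition on first parts yields the sets J and I. *)
Lemma head_lower_size X (la mu : intpart) n : head_lower X ->
  pad_entry X la mu n != 0 -> (psize la <= psize mu)%N.
Proof.
move=> XL; rewrite /pad_entry.
case El: (pad la n) => [a|]; last by rewrite eqxx.
case Em: (pad mu n) => [b|]; last by rewrite eqxx.
move=> /XL; rewrite (head_pad El) (head_pad Em).
by have := pad_psize El; have := pad_psize Em; lia.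
Qed.

Lemma pad_stable_block X e (la mu : intpart) k n n' :
  head_lower X -> pad_stable X e -> (psize mu <= k)%N ->
  (2 * k + e <= n)%N -> (2 * k + e <= n')%N ->
  pad_entry X la mu n = pad_entry X la mu n'.
Proof.
move=> XL XS mk kn kn'; have [lm|lm] := leqP (psize la) (psize mu).
  by rewrite (XS _ _ lm) ?[RHS](XS _ _ lm) //; lia.
have Z m : pad_entry X la mu m = 0.
  by apply: contraTeq lm => /(head_lower_size XL); rewrite -leqNgt.
by rewrite !Z.
Qed.

Lemma pad_inverses X Y (la mu : intpart) k n :
  head_lower Y -> inverses X Y ->
  (psize la <= k)%N -> (psize mu <= k)%N -> (2 * k <= n)%N ->
  \sum_(nu <- parts_upto k) pad_entry X la nu n * pad_entry Y nu mu n
    = (la == mu)%:R.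
Proof.
move=> YL XY lk mk kn.
have [a Ea] := pad_defined lk kn; have [b Eb] := pad_defined mk kn.
have -> : (la == mu) = (a == b).
  apply/eqP/eqP => [E|E]; first by move: Ea; rewrite E Eb => -[].
  by apply: (pad_inj Ea); rewrite E.
rewrite -XY (@sum_pad _ _ k).
  apply: eq_bigr => nu _; rewrite /pad_entry Ea Eb.
  by case: (pad nu n) => //=; rewrite mul0r.
move=> nu c Ec; rewrite mulf_eq0 negb_or => /andP[_ /YL].
rewrite (head_pad Eb) (head_pad Ec).
by have := pad_psize Eb; have := pad_psize Ec; lia.
Qed.

(** For [n] large the padded entries with tails of size at most [k] form a
    diagonal block of [X], whose inverse is the corresponding block of the
    inverse of [X]. *)
Lemma inverse_pad_stable X Y e : head_lower X -> head_lower Y ->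
  inverses X Y -> inverses Y X -> pad_stable X e -> pad_stable Y e.
Proof.
move=> XL YL XY YX XS la mu lm n le_n.
set n0 := (2 * psize mu + e)%N; set k := psize mu.
have kn : (2 * k <= n)%N by rewrite /k; lia.
have kn0 : (2 * k <= n0)%N by rewrite /k /n0; lia.
have unit_r Z : \sum_(nu <- parts_upto k) Z nu * (nu == mu)%:R = Z mu :> C.
  rewrite (bigD1_seq mu) ?undup_uniq ?mem_parts_upto //= eqxx mulr1.
  by rewrite big1 ?addr0 // => nu /negPf ->; rewrite mulr0.
have unit_l Z : \sum_(nu <- parts_upto k) (la == nu)%:R * Z nu = Z la :> C.
  rewrite (bigD1_seq la) ?undup_uniq ?mem_parts_upto //= eqxx mul1r.
  by rewrite big1 ?addr0 // => nu /negPf; rewrite eq_sym => ->; rewrite mul0r.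
rewrite -[LHS](unit_r (fun nu => pad_entry Y la nu n)).
rewrite -[RHS](unit_l (fun nu => pad_entry Y nu mu n0)).
under eq_big_seq => nu; first rewrite mem_parts_upto => nuk.
  rewrite -(pad_inverses YL XY nuk (leqnn k) kn0) mulr_sumr; over.
under [RHS]eq_big_seq => nu; first rewrite mem_parts_upto => nuk.
  rewrite -(pad_inverses XL YX lm nuk kn) mulr_suml; over.
rewrite exchange_big /=; apply: eq_big_seq => nu; rewrite mem_parts_upto => nuk.
apply: eq_bigr => ka _; rewrite mulrA; congr (_ * _ * _).
exact: (pad_stable_block _ XL XS nuk).
Qed.

(** The inverse is again triangular for dominance, and a dominance relation
    compares the first parts. *)
Lemma dominance_inverse X :
  (forall n (a b : intpartn n), X n a b != 0 -> dominated b a) ->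
  (forall n (a : intpartn n), X n a a != 0) ->
  exists Y, [/\ head_lower X, head_lower Y, inverses X Y & inverses Y X].
Proof.
move=> XL Xd.
have inv n : exists Y : intpartn n -> intpartn n -> C,
    [/\ forall a b, Y a b != 0 -> dominated b a,
        forall a b, \sum_c Y a c * X n c b = (a == b)%:R
      & forall a b, \sum_c X n a c * Y c b = (a == b)%:R].
  have [||||Y [YL YX XY]] := @triangular_inverse C (intpartn n)
      (fun a b => `[< dominated a b >]) (X n).
  - by move=> b a c /asboolP ab /asboolP bc; apply/asboolP/(dominated_trans ab).
  - move=> a b /andP[/asboolP ab /asboolP ba].
    exact/val_inj/dominated_anti.
  - by move=> a b /XL ?; apply/asboolP.
  - exact: Xd.
  by exists Y; split=> // a b /YL /asboolP.
exists (fun n => projT1 (cid (inv n))).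
split=> n a b; try by case: (cid (inv n)) => /= Y [].
  by move=> /XL /dominated_head.
by case: (cid (inv n)) => /= Y [YL _ _] /YL /dominated_head.
Qed.

End PartitionMatrices.

(** * Transfer of stability between bases *)

Lemma index_leP (T : Type) (u : nat -> T) b :
  index_le (stab_index u) b <-> forall n, (b <= n)%N -> u n = u b.
Proof.
rewrite /stab_index; case: pselect => [ex|nex] /=; split=> //.
- case: ex_minnP => m /asboolP Hm _ mb n bn.
  by rewrite -(subnKC (leq_trans mb bn)) -Hm -(subnKC mb) -Hm.
- move=> H; case: ex_minnP => m _; apply; apply/asboolP => k.
  by rewrite H ?leq_addr.
move=> H; case: nex; exists b; apply/asboolP => k.
by rewrite H ?leq_addr.
Qed.

Definition ultimately_constant (T : Type) (u : nat -> T) :=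
  exists b, forall n, (b <= n)%N -> u n = u b.

Lemma stab_indexP (T : Type) (u : nat -> T) :
  stab_index u <> None <-> ultimately_constant u.
Proof.
split=> [|[b /index_leP]]; last by case: stab_index.
case E: (stab_index u) => [b|] // _; exists b; apply/index_leP.
by rewrite E /=.
Qed.

Lemma ultimately_constant_ge (T : Type) (u : nat -> T) b :
  (forall n, (b <= n)%N -> u n = u b) ->
  forall n m, (b <= n)%N -> (b <= m)%N -> u n = u m.
Proof. by move=> H n m bn bm; rewrite H // [RHS]H. Qed.

Section Transfer.
Variable R : realType.
Local Notation C := R[i].
Implicit Types (f g : intpart -> symfam R) (X Y : pmat C).

Definition expands f g X := forall n (a : intpartn n) N,
  f a N = \sum_b X n a b *: g b N.

(** Uniqueness is required for arbitrary families [G], so that coordinates can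
    be computed for families that are not yet known to be symmetric. *)
Definition is_basis f := forall n,
  (forall G, Lambda n G -> exists c : {ffun intpartn n -> C}, expansion f G c) /\
  (forall G (c d : {ffun intpartn n -> C}), expansion f G c -> expansion f G d -> c = d).

Definition transpose X : pmat C := fun n a b => X n b a.

Lemma inverses_transpose X Y :
  inverses X Y -> inverses (transpose Y) (transpose X).
Proof.
move=> XY n a b; rewrite eq_sym -XY.
by apply: eq_bigr => c _; rewrite mulrC.
Qed.

Lemma expands_inverse f g X Y :
  inverses Y X -> expands f g X -> expands g f Y.
Proof.
move=> YX fg n b N.
under eq_bigr => a _ do rewrite fg scaler_sumr.
rewrite exchange_big /= (bigD1 b) //=.
have E c : \sum_a Y n b a *: (X n a c *: g c N) = (b == c)%:R *: g c N.
  by rewrite -YX scaler_suml; apply: eq_bigr => a _; rewrite scalerA.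
rewrite E eqxx scale1r big1 ?addr0 // => c /negPf.
by rewrite E eq_sym => ->; rewrite scale0r.
Qed.

Lemma expansion_expands n f g X G (c : {ffun intpartn n -> C}) :
  expands f g X -> expansion f G c ->
  expansion g G [ffun b => \sum_a c a * X n a b].
Proof.
move=> fg Gc N; rewrite Gc.
under eq_bigr => a _ do rewrite fg scaler_sumr.
rewrite exchange_big /=; apply: eq_bigr => b _.
by rewrite ffunE scaler_suml; apply: eq_bigr => a _; rewrite scalerA.
Qed.

Lemma is_basis_expands f g X Y :
  inverses X Y -> inverses Y X -> expands f g X -> is_basis f -> is_basis g.
Proof.
move=> XY YX fg fB n; have [fS fF] := fB n; split.
  by move=> G /fS[c Gc]; eexists; apply: expansion_expands fg Gc.
have gf := expands_inverse YX fg.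
move=> G c d /(expansion_expands gf) Gc /(expansion_expands gf) Gd.
have E := fF _ _ _ Gc Gd.
have K (e : {ffun intpartn n -> C}) b :
    \sum_a (\sum_b' e b' * Y n b' a) * X n a b = e b.
  under eq_bigr => a _ do rewrite mulr_suml.
  rewrite exchange_big /= (bigD1 b) //=.
  have E' b' : \sum_a e b' * Y n b' a * X n a b = e b' * (b' == b)%:R.
    by rewrite -YX mulr_sumr; apply: eq_bigr => a _; rewrite mulrA.
  rewrite E' eqxx mulr1 big1 ?addr0 // => b' /negPf.
  by rewrite E' => ->; rewrite mulr0.
apply/ffunP => b; rewrite -(K c) -(K d); apply: eq_bigr => a _; congr (_ * _).
by move/ffunP/(_ a): E; rewrite !ffunE.
Qed.

Lemma coord_eq f n G (c : {ffun intpartn n -> C}) :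
  is_basis f -> expansion f G c -> Defs.coord n f G = c.
Proof.
move=> fB Gc; have [_ fF] := fB n.
rewrite /Defs.coord; case: xgetP => [d _ Gd|/(_ c)//].
exact: fF Gd Gc.
Qed.

Lemma trans_coefE f g X la mu n : is_basis g -> expands f g X ->
  trans_coef f g la mu n = pad_entry X la mu n.
Proof.
move=> gB fg; rewrite /trans_coef /pad_entry.
case: (pad la n) => [a|] //; case: (pad mu n) => [b|] //.
by rewrite (@coord_eq _ _ _ [ffun b => X n a b] gB) ?ffunE // => N; rewrite fg;
  apply: eq_bigr => c _; rewrite ffunE.
Qed.

Lemma coord_expands f g X n G : is_basis f -> is_basis g -> expands f g X ->
  Lambda n G -> forall b, Defs.coord n g G b = \sum_a Defs.coord n f G a * X n a b.
Proof.
move=> fB gB fg LG b; have [/(_ _ LG)[c Gc] _] := fB n.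
by rewrite (coord_eq gB (expansion_expands fg Gc)) ffunE (coord_eq fB Gc).
Qed.

Lemma padded_coef_expands f g X F k mu n :
  is_basis f -> is_basis g -> expands f g X -> Lambda n (F n) ->
  (forall la, padded_coef f F la n * pad_entry X la mu n != 0 -> (psize la <= k)%N) ->
  padded_coef g F mu n =
    \sum_(la <- parts_upto k) padded_coef f F la n * pad_entry X la mu n.
Proof.
move=> fB gB fg LF Hk; rewrite /padded_coef /pad_entry.
case Em: (pad mu n) => [b|]; last first.
  by rewrite big1 // => la _; case: (pad la n) => [a|]; rewrite mulr0.
rewrite (coord_expands fB gB fg LF) (@sum_pad _ _ k).
  by apply: eq_bigr => la _; case: (pad la n) => [a|] //=; rewrite mulr0.
by move=> la a El H; apply: Hk; rewrite /padded_coef /pad_entry El Em.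
Qed.

Lemma ultimately_constant_sum (I : Type) (r : seq I) (u : I -> nat -> C) :
  (forall i, ultimately_constant (u i)) ->
  ultimately_constant (fun n => \sum_(i <- r) u i n).
Proof.
move=> H; elim: r => [|i r [b Hb]].
  by exists 0%N => n _; rewrite !big_nil.
have [c Hc] := H i; exists (maxn b c) => n; rewrite geq_max => /andP[bn cn].
rewrite !big_cons Hc // [in RHS]Hc ?leq_maxr //; congr (_ + _).
by rewrite Hb // [RHS]Hb ?leq_maxl.
Qed.

(** A new coefficient is the sum, over the tails of size at most [|mu|], of old
    coefficients times entries of [X]: a finite sum, with a fixed range, of
    ultimately constant sequences. *)
Lemma stable_expands f g X e F :
  is_basis f -> is_basis g -> expands f g X -> head_lower X -> pad_stable X e ->
  (forall n, Lambda n (F n)) -> stable f F -> stable g F.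
Proof.
move=> fB gB fg XL XS LF fF mu; apply/stab_indexP.
have E n : padded_coef g F mu n = \sum_(la <- parts_upto (psize mu))
    padded_coef f F la n * pad_entry X la mu n.
  apply: padded_coef_expands => // la.
  by rewrite mulf_eq0 negb_or => /andP[_]; apply: head_lower_size.
rewrite (_ : padded_coef g F mu = fun n => \sum_(la <- parts_upto (psize mu))
    padded_coef f F la n * pad_entry X la mu n); last exact/funext.
apply: ultimately_constant_sum => la.
have /stab_indexP[b Hb] := fF la.
exists (b + (2 * psize mu + e))%N => n bn; congr (_ * _).
  by apply: (ultimately_constant_ge Hb); lia.
by apply: (pad_stable_block _ XL XS (leqnn _)); lia.
Qed.

(** If the coefficients are constant from rank [b] on, those with [|la| > b]
    vanish from there on, since they vanish at [b] where the padding is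
    undefined.  The remaining ones interact with tails of size at most [b]. *)
Lemma unif_stable_expands f g X e F :
  is_basis f -> is_basis g -> expands f g (transpose X) ->
  head_lower X -> pad_stable X e ->
  (forall n, Lambda n (F n)) -> unif_stable f F -> unif_stable g F.
Proof.
move=> fB gB fg XL XS LF [b Hb].
have {}Hb la n m : (b <= n)%N -> (b <= m)%N ->
    padded_coef f F la n = padded_coef f F la m.
  by move: n m; apply: ultimately_constant_ge; apply/index_leP/Hb.
have E mu n : (b <= n)%N -> padded_coef g F mu n =
    \sum_(la <- parts_upto b) padded_coef f F la n * pad_entry X mu la n.
  move=> bn; rewrite (@padded_coef_expands f g (transpose X) F b) //.
    apply: eq_bigr => la _; congr (_ * _); rewrite /pad_entry.
    by case: (pad la n) => [a|]; case: (pad mu n).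
  move=> la; rewrite mulf_eq0 negb_or => /andP[+ _].
  rewrite (Hb _ _ b) // /padded_coef; case El: (pad la b) => [a|]; last by rewrite eqxx.
  by move=> _; apply: pad_psize El.
(* Both the coefficients (from b) and the entries (from 2b + e) are constant. *)
exists (b + (2 * b + e))%N => mu; apply/index_leP => n bn.
rewrite !E; [|lia..]; apply: eq_big_seq => la; rewrite mem_parts_upto => lb.
congr (_ * _); first by apply: Hb; lia.
by apply: (pad_stable_block _ XL XS lb); lia.
Qed.

Lemma Iset_expands f g X la : is_basis g -> expands f g (transpose X) ->
  head_lower X -> (Iset f g la `<=` [set mu | (psize mu <= psize la)%N])%classic.
Proof.
move=> gB fg XL mu [n]; rewrite (trans_coefE _ _ _ gB fg) => H.
apply: (head_lower_size (n := n) XL); apply: contraNneq H; rewrite /pad_entry /transpose.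
by case: (pad la n) => [a|]; case: (pad mu n) => [b|] // ->.
Qed.

Lemma Jset_expands f g X mu : is_basis g -> expands f g X ->
  head_lower X -> (Jset f g mu `<=` [set la | (psize la <= psize mu)%N])%classic.
Proof.
move=> gB fg XL la [n]; rewrite (trans_coefE _ _ _ gB fg).
exact: head_lower_size.
Qed.

Lemma Nindex_expands f g X e la mu : is_basis g -> expands f g X ->
  pad_stable X e -> (psize la <= psize mu)%N ->
  index_le (Nindex f g la mu) (2 * psize mu + e).
Proof.
move=> gB fg XS lm; apply/index_leP => n le_n.
by rewrite !(trans_coefE _ _ _ gB fg) XS.
Qed.

Lemma is_basis_monomial : is_basis (monomial R).
Proof.
move=> n; split=> [G LG|G c d]; last exact: monomial_free.
by eexists; apply: Lambda_expansion.
Qed.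

End Transfer.

(** * Power sums *)

Section PowerSums.
Variable R : realType.
Local Notation C := R[i].

Definition psum N k : {mpoly C[N]} := \sum_(i < N) 'X_i ^+ k.

Lemma powersumE la N : powersum R la N = \prod_(k <- parts la) psum N k.
Proof. by []. Qed.

Lemma mcoeff_mulX N (m v : 'X_{1..N}) (p : {mpoly C[N]}) :
  ('X_[m] * p)@_v = if (m <= v)%MM then p@_(v - m) else 0.
Proof.
rewrite mulrC; case: ifP => [mv|mv].
  by rewrite -{1}(submK mv) addmC mcoeffMX.
apply: memN_msupp_eq0; rewrite (perm_mem (msuppMX p m)); apply/negP => /mapP[w _ vE].
by move: mv; rewrite vE lem_addr.
Qed.

Lemma mcoeff_mul_pow N i k (v : 'X_{1..N}) (p : {mpoly C[N]}) :
  ('X_i ^+ k * p)@_v = if (k <= v i)%N then p@_(v - U_(i) *+ k) else 0.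
Proof.
rewrite mpolyXn mcoeff_mulX; congr (if _ then _ else _).
apply/mnm_lepP/idP => [/(_ i)|kv j]; rewrite mulmnE mnm1E; first by rewrite eqxx mul1n.
by case: eqP => [<-|//]; rewrite mul1n.
Qed.

Lemma mcoeff_psum_mul N k (v : 'X_{1..N}) (p : {mpoly C[N]}) :
  (psum N k * p)@_v =
    \sum_(i < N) if (k <= v i)%N then p@_(v - U_(i) *+ k) else 0.
Proof.
by rewrite mulr_suml raddf_sum; apply: eq_bigr => i _; apply: mcoeff_mul_pow.
Qed.

Lemma psum_sym N k : psum N k \is symmetric.
Proof.
apply/issymP => s; rewrite /psum raddf_sum (reindex_perm s^-1) /=.
apply: eq_bigr => i _; rewrite rmorphXn /= msymX; congr ('X_[_] ^+ _).
by apply/mnmP => j; rewrite !mnmE (inj_eq perm_inj).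
Qed.

Lemma Lambda_powersum (la : intpart) : Lambda (psize la) (powersum R la).
Proof.
move=> N; split.
- by apply: rpred_prod => k _; apply: psum_sym.
- rewrite powersumE /psize; elim: (parts la) => [|k s IH].
    by rewrite big_nil; apply: dhomog1.
  rewrite big_cons /=; apply: dhomogM => //.
  by apply: rpred_sum => i _; rewrite mpolyXn dhomogX /= mdegMn mdeg1 mul1n.
- rewrite /drop_last_var !powersumE rmorph_prod /=; apply: eq_big_seq => k kla.
  have k0 : k != 0%N by apply: contraNneq (parts_gt0 la) => <-.
  rewrite raddf_sum /= big_ord_recr /= rmorphXn /= comp_mpolyX.
  have X0 (i : 'I_N.+1) (t : N.+1.-tuple {mpoly C[N]}) :
      \prod_(j < N.+1) tnth t j ^+ U_(i)%MM j = tnth t i.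
    rewrite (bigD1 i) //= mnm1E eqxx expr1 big1 ?mulr1 // => j ji.
    by rewrite mnm1E eq_sym (negPf ji).
  rewrite X0 tnth_mktuple unlift_none expr0n (negPf k0) addr0.
  apply: eq_bigr => i _; rewrite rmorphXn /= comp_mpolyX X0 tnth_mktuple.
  by rewrite widen_lift_max liftK.
Qed.

Lemma Lambda_powersum_n n (a : intpartn n) : Lambda n (powersum R a).
Proof. by rewrite -[X in Lambda X](psizeE a); apply: Lambda_powersum. Qed.

(** This is the Hall scalar product of [h_a] and [p_b], which is why it also
    governs the expansion of [h_a] in the basis [p/z]. *)
Definition power_coef : pmat C := fun n a b => mon_coef n (powersum R b) a.

Lemma powersum_expands :
  expands (powersum R) (monomial R) (transpose power_coef).
Proof.
move=> n b N; rewrite (Lambda_expansion (Lambda_powersum_n b)).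
by apply: eq_bigr => a _; rewrite ffunE.
Qed.

(** Expanding the product amounts to distributing the entries of [s] among the
    variables. *)
Lemma mcoeff_prod_psum N (s : seq nat) (v : 'X_{1..N}) :
  (\prod_(k <- s) psum N k)@_v =
  #|[pred f : {ffun 'I_(size s) -> 'I_N} |
     [forall i, v i == \sum_(j | f j == i) nth 0%N s j]%N]|%:R.
Proof.
rewrite (big_nth 0%N) big_mkord bigA_distr_bigA /= raddf_sum /=.
rewrite -sum1_card natr_sum [RHS]big_mkcond /=; apply: eq_bigr => f _.
under eq_bigr => j _ do rewrite mpolyXn.
rewrite mprodXE mcoeffX inE; set b := [forall i, _].
rewrite (_ : (if b then 1 else 0) = b%:R); last by case: (b).
congr (_%:R); congr nat_of_bool; apply/eqP/forallP => [<- i|H].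
  apply/eqP; rewrite mnm_sumE [RHS]big_mkcond /=; apply: eq_bigr => j _.
  by rewrite mulmnE mnm1E; case: eqP; rewrite ?mul1n.
apply/mnmP => i; rewrite (eqP (H i)) mnm_sumE [RHS]big_mkcond /=.
by apply: eq_bigr => j _; rewrite mulmnE mnm1E; case: eqP; rewrite ?mul1n.
Qed.

(** The source of all dominance relations: the entries indexed by [A] form a
    sub-multiset of the parts completed with zeros. *)
Lemma sum_subset_dominated N (v : 'X_{1..N}) (A : {set 'I_N}) :
  (\sum_(i in A) v i <= sumn (take #|A| (part_of v)))%N.
Proof.
set la := part_of v; set s := parts la ++ nseq (N - size la) 0%N.
have ss : sorted geq s.
  rewrite /s; move: (parts_sorted la); case: (parts la) => [_|x t /=].
    by rewrite /=; elim: (N - _)%N => [|[|j] IH].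
  rewrite cat_path => -> /=; elim: (N - _)%N (last x t) => //= j IH y.
have tk k : sumn (take k s) = sumn (take k la).
  rewrite /s take_cat; case: ltnP => // /take_oversize ->.
  rewrite sumn_cat (_ : sumn (take _ _) = 0)%N ?addn0 //.
  by elim: (N - _)%N (k - _)%N => [|l IH] [|j] //=; rewrite IH.
have -> : (\sum_(i in A) v i = sumn [seq v i | i <- enum A])%N.
  by rewrite sumnE big_map big_enum.
have -> : #|A| = size [seq v i | i <- enum A] by rewrite size_map -cardE.
rewrite -tk; apply: (@sumn_take_sorted _ _ [seq v i | i <- enum (~: A)]) => //.
apply: (@perm_trans _ v); last first.
  by have := perm_pad_zeros (part_ofP v); rewrite size_tuple.
rewrite -map_cat (mnm_seqE v) perm_map //.
apply: uniq_perm; rewrite ?enum_uniq // ?cat_uniq ?enum_uniq /= ?andbT.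
  by apply/hasPn => i; rewrite !mem_enum inE.
by move=> i; rewrite mem_cat !mem_enum !inE orbN.
Qed.

Lemma leq_sumn_take k l (s : seq nat) :
  (k <= l)%N -> (sumn (take k s) <= sumn (take l s))%N.
Proof.
elim: s k l => [|x s IH] [|k] [|l] //= kl.
by rewrite leq_add2l IH.
Qed.

Lemma size_intpartn n (a : intpartn n) : (size a <= n)%N.
Proof. by rewrite -[X in (_ <= X)%N](psizeE a) size_le_psize. Qed.

Lemma part_of_intpartn n (a : intpartn n) : part_of (mnm_of n a) = a.
Proof. by rewrite part_of_mnm_of ?size_intpartn. Qed.

(** If distributing the parts of [b] among the variables produces the parts of
    [a], the [k] largest parts of [b] go to at most [k] variables, whose
    exponents sum to at most the [k] largest parts of [a]. *)
Lemma power_coef_dominated n (a b : intpartn n) :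
  power_coef a b != 0 -> dominated b a.
Proof.
rewrite /power_coef /mon_coef powersumE mcoeff_prod_psum.
rewrite pnatr_eq0 -lt0n => /card_gt0P[f]; rewrite inE => /forallP fP k.
set v := mnm_of n a in fP.
have [kb|bk] := leqP k (size b); last first.
  have -> : sumn (take k b) = psize a.
    by rewrite take_oversize ?(ltnW bk) // -/(psize b) !psizeE.
  have [ka|ak] := leqP (size a) k; first by rewrite take_oversize.
  pose A := [set f j | j in 'I_(size b)].
  have cA : (#|A| <= k)%N.
    by apply: leq_trans (leq_imset_card _ _) _; rewrite card_ord ltnW.
  apply: leq_trans (leq_sumn_take a cA).
  apply: leq_trans (_ : \sum_(i in A) v i <= _)%N; last first.
    by have := sum_subset_dominated v A; rewrite part_of_intpartn.
  rewrite -part_of_intpartn psize_part_of_mnm mdegE.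
  rewrite (bigID (mem A)) /= [X in (_ + X)%N]big1 ?addn0 // => i iA.
  rewrite (eqP (fP i)) big_pred0 // => j; apply: contraNF iA => /eqP <-.
  exact: imset_f.
pose A := [set f j | j in [set j : 'I_(size b) | (j < k)%N]].
have cA : (#|A| <= k)%N.
  apply: leq_trans (leq_imset_card _ _) _.
  rewrite -sum1dep_card (big_ord_narrow kb) /= sum1_card card_ord //.
apply: leq_trans (leq_sumn_take a cA).
apply: leq_trans (_ : \sum_(i in A) v i <= _)%N; last first.
  by have := sum_subset_dominated v A; rewrite part_of_intpartn.
have -> : sumn (take k b) = (\sum_(j < size b | j < k) nth 0 b j)%N.
  rewrite sumnE (big_nth 0%N) size_take_min (minn_idPl kb) big_mkord.
  rewrite (big_ord_narrow kb) /=; apply: eq_bigr => j _.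
  by rewrite nth_take.
rewrite (partition_big f (mem A)) /=; last first.
  by move=> j jk; apply: imset_f; rewrite inE.
apply: leq_sum => i _; rewrite (eqP (fP i)) [X in (X <= _)%N]big_mkcondl /=.
by apply: leq_sum => j _; case: ifP.
Qed.

(** Sending each part to the variable of the same rank is one of the
    distributions that are counted. *)
Lemma power_coef_diag n (a : intpartn n) : power_coef a a != 0.
Proof.
rewrite /power_coef /mon_coef powersumE mcoeff_prod_psum.
rewrite pnatr_eq0 -lt0n; apply/card_gt0P.
exists [ffun j => widen_ord (size_intpartn a) j]; rewrite inE; apply/forallP => i.
rewrite mnmE; have [ia|ai] := ltnP i (size a).
  rewrite (big_pred1 (Ordinal ia)) // => j; rewrite ffunE.
  by apply/eqP/eqP => E; apply/val_inj; [move/(congr1 val): E|rewrite E].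
rewrite nth_default // big_pred0 // => j; rewrite ffunE; apply/eqP => E.
by move: ai; rewrite -E /= leqNgt ltn_ord.
Qed.

(** For [n > 2|mu|] the first part [n - |mu|] of [mu[n]] exceeds every part of
    [la], so its power sum contributes the first variable only.  Dividing by
    this power leaves the exponent [(|mu| - |la|, la)] in [p_mu], which does not
    involve [n]. *)
Lemma power_coef_stable : pad_stable power_coef 1.
Proof.
have key (la mu : intpart) n N : (psize la <= psize mu)%N ->
    (2 * psize mu + 1 <= n)%N -> (n <= N.+1)%N ->
    pad_entry power_coef la mu n = (powersum R mu N.+1)@_
      (mnm_of N.+1 ((psize mu - psize la)%N :: la)).
  move=> lm nm nN; rewrite /pad_entry.
  have [a Ea] := @pad_defined la (psize mu) n lm ltac:(lia).
  have [b Eb] := @pad_defined mu (psize mu) n (leqnn _) ltac:(lia).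
  rewrite Ea Eb /power_coef /mon_coef.
  rewrite (Lambda_mcoeff (Lambda_powersum_n b) (size_intpartn a) nN) !powersumE.
  have [_ ->] := pad_Some Eb; have [_ Eas] := pad_Some Ea.
  have -> : pad_seq mu n = (n - psize mu)%N :: mu.
    by rewrite /pad_seq; case: n {a b Ea Eb Eas nN} nm => //; lia.
  rewrite big_cons mcoeff_psum_mul (bigD1 ord0) //= [X in _ + X]big1 ?addr0.
    have -> : (n - psize mu <= mnm_of N.+1 a ord0)%N.
      by rewrite mnmE Eas pad_seq0; lia.
    congr (mcoeff _ _); apply/mnmP => i; rewrite mnmBE mulmnE mnm1E !mnmE.
    have [->|i0] := eqVneq i ord0; rewrite Eas.
      by rewrite mul1n pad_seq0 //=; lia.
    case: i i0 => -[|i] //= iN _; rewrite pad_seqS; last by lia.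
    by rewrite mul0n subn0.
  case=> -[|i] //= iN _; rewrite mnmE Eas pad_seqS; last by lia.
  case: ifP => // h; have := nth_le_psize la i; rewrite /= in h; lia.
move=> la mu lm n nm; rewrite (key _ _ _ n) // ?leqW // [RHS](key _ _ _ n) //.
by rewrite leqW.
Qed.

(** * Complete homogeneous functions in terms of power sums *)

Lemma mcoeff_complete1 k N (v : 'X_{1..N}) :
  (complete1 R k N)@_v = (mdeg v == k)%:R.
Proof.
rewrite /complete1 raddf_sum /=.
under eq_bigr => m _ do rewrite mcoeffX.
have [E|E] := eqVneq (mdeg v) k; last first.
  rewrite big1 // => m /eqP mk; case: eqP => // mv; by rewrite -mv mk eqxx in E.
have lt : (mdeg v < k.+1)%N by rewrite E.
rewrite (bigD1 (BMultinom lt)) /= ?E ?eqxx // big1 ?addr0 //.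
by move=> m /andP[_ nm]; case: eqP => // mv; case/eqP: nm; apply/val_inj.
Qed.

Lemma mnm_le_mdeg N (v : 'X_{1..N}) i : (v i <= mdeg v)%N.
Proof. by rewrite mdegE (bigD1 i) //= leq_addr. Qed.

Lemma mdeg_subU N (v : 'X_{1..N}) i k :
  (k <= v i)%N -> mdeg (v - U_(i) *+ k) = (mdeg v - k)%N.
Proof.
move=> kv; have le : (U_(i) *+ k <= v)%MM.
  apply/mnm_lepP => j; rewrite mulmnE mnm1E.
  by case: eqP => [<-|//]; rewrite mul1n.
by rewrite -{2}(submK le) mdegD mdegMn mdeg1 mul1n addnK.
Qed.

Lemma sum_lt_const k m : (m <= k)%N -> (\sum_(j < k) (j < m : nat) = m)%N.
Proof.
move=> mk; rewrite -big_mkcond /= sum1dep_card.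
have -> : #|[set j : 'I_k | (j < m)%N]| = \sum_(j < k | (j < m)%N) 1 by rewrite sum1dep_card.
by rewrite (big_ord_narrow mk) /= sum1_card card_ord.
Qed.

(** Newton's identity: the coefficient of [x^v] on the right counts the pairs
    [(i, j)] with [j < v i], and there are [mdeg v] of them. *)
Lemma newton_complete k N :
  k%:R *: complete1 R k N =
    \sum_(j < k) psum N j.+1 * complete1 R (k - j.+1) N.
Proof.
apply/mpolyP => v; rewrite mcoeffZ mcoeff_complete1 raddf_sum /=.
under eq_bigr => j _.
  rewrite mcoeff_psum_mul.
  under eq_bigr => i _ do rewrite mcoeff_complete1.
  over.
have E (j : 'I_k) i :
    (if (j < v i)%N then (mdeg (v - U_(i) *+ j.+1) == (k - j.+1)%N)%:R else 0 : C) =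
    (mdeg v == k)%:R * (j < v i)%N%:R.
  case: ifP => [jv|]; last by rewrite mulr0.
  rewrite mdeg_subU // mulr1; congr (_%:R); congr nat_of_bool.
  by have h1 := mnm_le_mdeg v i; have h2 := ltn_ord j; apply/idP/idP; lia.
under eq_bigr => j _ do (under eq_bigr => i _ do rewrite E; rewrite -mulr_sumr).
rewrite -mulr_sumr exchange_big /=.
have [vk|_] := eqVneq (mdeg v) k; last by rewrite mul0r mulr0.
rewrite mul1r mulr1 -vk {1}mdegE natr_sum; apply: eq_bigr => i _.
by rewrite -natr_sum sum_lt_const // mnm_le_mdeg.
Qed.

Lemma zeeE (la : intpart) n : (psize la <= n)%N ->
  zee la = (\prod_(j < n) (j.+1 ^ count_mem j.+1 la * (count_mem j.+1 la)`!))%N.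
Proof.
move=> lan; rewrite /zee big_add1 /=.
rewrite -(big_mkord xpredT (fun j => j.+1 ^ count_mem j.+1 la * (count_mem j.+1 la)`!)%N).
rewrite [RHS](big_cat_nat _ (n := psize la)) //=.
rewrite [X in _ = (_ * X)%N]big_nat_cond [X in _ = (_ * X)%N]big1 ?muln1 //.
move=> j; rewrite andbT => /andP[lj _].
have -> : count_mem j.+1 la = 0%N; last by rewrite expn0.
apply/count_memPn/negP => /(nthP 0%N)[i _ E].
by have := nth_le_psize la i; rewrite E; lia.
Qed.

Lemma parts_part_of_cons k (c : intpart) : k != 0%N ->
  perm_eq (part_of (k :: c)) (k :: c).
Proof.
move=> k0; rewrite perm_sym; have := part_ofP (k :: c); rewrite /= k0.
rewrite (_ : [seq x <- c | x != 0%N] = c) //.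
by apply/all_filterP/allP => x xc; apply: contraNneq (parts_gt0 c) => <-.
Qed.

Lemma psize_part_of_cons k (c : intpart) : psize (part_of (k :: c)) = (k + psize c)%N.
Proof. exact: psize_part_of. Qed.

Lemma zee_part_of_cons k (c : intpart) :
  zee (part_of (k.+1 :: c)) = (zee c * (k.+1 * (count_mem k.+1 c).+1))%N.
Proof.
set n := (k.+1 + psize c)%N; have kn : (k < n)%N by rewrite /n; lia.
rewrite (@zeeE _ n) ?psize_part_of_cons // (@zeeE c n) ?leq_addl //.
have cnt j : count_mem j (part_of (k.+1 :: c)) = ((k.+1 == j) + count_mem j c)%N.
  by move/seq.permP: (parts_part_of_cons c (isT : k.+1 != 0%N)) => ->.
rewrite (bigD1 (Ordinal kn)) //= [in RHS](bigD1 (Ordinal kn)) //= cnt eqxx add1n.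
rewrite (eq_bigr (fun j : 'I_n => j.+1 ^ count_mem j.+1 c * (count_mem j.+1 c)`!)%N).
  by rewrite expnS factS; ring.
move=> j jk; rewrite cnt (_ : k.+1 == j.+1 = false) // eqSS.
by apply: contraNF jk => /eqP kj; apply/eqP/val_inj.
Qed.

Lemma sum_count_parts n (b : intpartn n) :
  (\sum_(j < n) j.+1 * count_mem j.+1 b = n)%N.
Proof.
have b0 := parts_gt0 b; have bn (k : nat) : k \in parts b -> (k <= n)%N.
  by move=> /(nthP 0%N)[i _ <-]; rewrite -[X in (_ <= X)%N](psizeE b) nth_le_psize.
rewrite -[RHS](psizeE b) /psize; elim: (parts b) b0 bn => [|k s IH] b0 bn.
  by rewrite big1 // => j _; rewrite muln0.
rewrite inE negb_or eq_sym in b0; case/andP: b0 => k0 s0.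
under eq_bigr => j _ do rewrite /= mulnDr.
rewrite big_split /= IH //; last by move=> x xs; apply: bn; rewrite inE xs orbT.
congr (_ + _)%N; case: k k0 bn => // k _ bn.
have kn : (k < n)%N by apply: bn; rewrite mem_head.
rewrite (bigD1 (Ordinal kn)) //= eqxx muln1 big1 ?addn0 // => j jk.
rewrite eqSS (_ : k == j = false) ?muln0 //.
by apply: contraNF jk => /eqP kj; apply/eqP/val_inj.
Qed.

(** Marking a part [k] of a partition, with weight [k] times its multiplicity,
    amounts to adding a part [k] to a smaller partition. *)
Lemma zee_recursion (V : lmodType C) n (phi : intpart -> V) :
  n%:R *: (\sum_(b : intpartn n) (zee b)%:R^-1 *: phi b) =
  \sum_(k < n) \sum_(c : intpartn (n - k.+1))
     (zee c)%:R^-1 *: phi (part_of (k.+1 :: c)).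
Proof.
rewrite scaler_sumr.
under eq_bigr => b _.
  rewrite -{1}(sum_count_parts b) natr_sum scaler_suml; over.
rewrite exchange_big /=; apply: eq_bigr => k _.
have kn : (k.+1 + (n - k.+1))%N = n by rewrite subnKC.
pose h (c : intpartn (n - k.+1)) : intpartn n := sval (intpartn_of
  (etrans (psize_part_of_cons k.+1 c) (etrans (congr1 (addn k.+1) (psizeE c)) kn))).
have hE c : h c = part_of (k.+1 :: c) :> intpart by rewrite /h; case: intpartn_of.
have hp c : perm_eq (h c) (k.+1 :: c) by rewrite hE parts_part_of_cons.
have hI : injective h.
  move=> c d hcd; apply/val_inj/parts_perm_inj.
  by rewrite -(perm_cons k.+1) -(permPl (hp c)) hcd.
rewrite (bigID (fun b => b \in h @: predT)) /= [X in _ + X]big1 ?addr0; last first.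
  move=> b bh; suff -> : count_mem k.+1 b = 0%N by rewrite muln0 scale0r.
  apply/count_memPn; apply: contraNN bh => kb; apply/imsetP.
  have rs : psize (part_of (rem k.+1 b)) = (n - k.+1)%N.
    rewrite psize_part_of -[X in (X - _)%N](psizeE b) /psize.
    by rewrite (perm_sumn (perm_to_rem kb)) /= addKn.
  have [c cE] := intpartn_of rs; exists c; rewrite ?inE //.
  apply/val_inj/parts_perm_inj; rewrite (permPr (hp c)) (permPl (perm_to_rem kb)).
  rewrite perm_cons cE -(permPr (part_ofP _)) (_ : [seq x <- _ | _] = rem k.+1 b) //.
  apply/all_filterP/allP => x /mem_rem xb.
  by apply: contraNneq (parts_gt0 b) => <-.
rewrite big_imset /=; last by move=> c d _ _; apply: hI.
apply: eq_big => [c|c _]; first by rewrite inE.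
rewrite hE zee_part_of_cons scalerA; congr (_ *: _).
have -> : count_mem k.+1 (part_of (k.+1 :: c)) = (count_mem k.+1 c).+1.
  by move/seq.permP: (parts_part_of_cons c (isT : k.+1 != 0%N)) => ->; rewrite /= eqxx.
by rewrite mulrC [(zee c * _)%:R]natrM invfM -mulrA mulVf ?mulr1 // pnatr_eq0 muln_eq0.
Qed.

(** The Cauchy identity, at the coefficient of [y^al] of the product of the
    [1/(1 - x_i y_j)].  After multiplication by [|al|] both sides satisfy the
    same recursion on [al], which sums [p_k(x)] times the value at [al] minus
    [k] in position [j]: on the left by Newton's identity for each factor, on
    the right by marking a part of [b]. *)
Lemma complete_power_coef L N (al : 'X_{1..L}) :
  \prod_(j < L) complete1 R (al j) N =
  \sum_(b : intpartn (mdeg al))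
    (zee b)%:R^-1 *: ((powersum R b L)@_al *: powersum R b N).
Proof.
have [n] := ubnP (mdeg al); elim: n al => // n IH al /ltnSE aln.
have [al0|al0] := eqVneq (mdeg al) 0%N.
  have -> : al = 0%MM by apply/eqP; rewrite -mdeg_eq0 al0.
  have c0 : complete1 R 0 N = 1.
    by apply/mpolyP => v; rewrite mcoeff_complete1 mcoeff1 mdeg_eq0.
  rewrite big1 => [|j _]; last by rewrite mnm0E c0.
  have z0 (b : intpartn (mdeg (0%MM : 'X_{1..L}))) : parts b = [::].
    by apply/eqP; rewrite -size_eq0 -leqn0 -[X in (_ <= X)%N](@mdeg0 L) size_intpartn.
  have [b0 Eb0] := intpartn_of (esym (@mdeg0 L) : psize (part_of [::]) = _).
  rewrite (bigD1 b0) //= big1 ?addr0; last first.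
    by move=> b; case/eqP; apply/val_inj/val_inj; rewrite /= !z0.
  rewrite !powersumE z0 !big_nil mcoeff1 eqxx scale1r /zee /psize z0 big_nil.
  by rewrite invr1 scale1r.
have nz : (mdeg al)%:R != 0 :> C by rewrite pnatr_eq0.
apply: (scalerI nz); rewrite (zee_recursion _ (fun b : intpart =>
  (powersum R b L)@_al *: powersum R b N)).
have -> : (mdeg al)%:R *: \prod_(j < L) complete1 R (al j) N =
    \sum_(j < L) \sum_(k < mdeg al | (k < al j)%N)
      psum N k.+1 * \prod_(i < L) complete1 R ((al - U_(j) *+ k.+1)%MM i) N.
  rewrite {1}mdegE natr_sum scaler_suml; apply: eq_bigr => j _.
  rewrite (bigD1 j) //= mpoly_scaleAl newton_complete mulr_suml.
  rewrite [RHS](big_ord_narrow (mnm_le_mdeg al j)) /=.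
  apply: eq_bigr => k _; rewrite -mulrA; congr (_ * _).
  rewrite [RHS](bigD1 j) //= mnmBE mulmnE mnm1E eqxx mul1n; congr (_ * _).
  by apply: eq_bigr => i ij; rewrite mnmBE mulmnE mnm1E eq_sym (negPf ij) mul0n subn0.
rewrite (exchange_big_dep predT) //=; apply: eq_bigr => k _.
under [RHS]eq_bigr => c _.
  rewrite !powersumE !(perm_big _ (parts_part_of_cons c (isT : k.+1 != 0%N))) /=.
  rewrite !big_cons mcoeff_psum_mul -big_mkcond /= scaler_suml scaler_sumr.
  over.
rewrite exchange_big /=; apply: eq_bigr => j kj.
have lt : (mdeg (al - U_(j) *+ k.+1) < n)%N.
  by rewrite mdeg_subU //; have := mnm_le_mdeg al j; lia.
rewrite (IH _ lt) (mdeg_subU kj) mulr_sumr; apply: eq_bigr => c _.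
by rewrite -!scalerAr.
Qed.

Lemma complete_expands : expands (complete R) (powersumz R) power_coef.
Proof.
move=> n a N; have c0 : complete1 R 0 N = 1.
  by apply/mpolyP => v; rewrite mcoeff_complete1 mcoeff1 mdeg_eq0.
have -> : complete R a N = \prod_(j < n) complete1 R (mnm_of n a j) N.
  rewrite /complete (big_nth 0%N) big_mkord.
  rewrite (big_ord_widen _ (fun j => complete1 R (nth 0%N a j) N) (size_intpartn a)).
  rewrite big_mkcond /=; apply: eq_bigr => j _; rewrite mnmE.
  by case: ltnP => // aj; rewrite nth_default.
have E : mdeg (mnm_of n a) = n by rewrite mdeg_mnm_of ?size_intpartn ?psizeE.
rewrite complete_power_coef {}E; apply: eq_bigr => b _.
by rewrite /power_coef /mon_coef /powersumz !scalerA mulrC.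
Qed.

Lemma Lambda_powersumz n (a : intpartn n) : Lambda n (powersumz R a).
Proof.
move=> N; have [sa ha da] := Lambda_powersum_n a N; split.
- exact: rpredZ.
- exact: dhomogZ.
- by rewrite /drop_last_var linearZ /=; congr (_ *: _).
Qed.

Lemma Lambda_complete n (a : intpartn n) : Lambda n (complete R a).
Proof.
have -> : complete R a = fun N => \sum_b power_coef a b *: powersumz R b N.
  by apply/functional_extensionality_dep => N; rewrite complete_expands.
by apply: Lambda_sum => b; apply: Lambda_powersumz.
Qed.

End PowerSums.

(** * Schur functions *)

Section Schur.
Variable R : realType.
Local Notation C := R[i].

Definition stair N : 'X_{1..N} := [multinom N - i.+1 | i < N].

Definition strict N (v : 'X_{1..N}) := forall i j : 'I_N, (i < j)%N -> (v j < v i)%N.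

Lemma alternantE N (s : seq nat) :
  alternant R N s =
  \sum_(w : 'S_N) (-1) ^+ w *: 'X_[(mnm_of N s + stair N)%MM # w].
Proof.
rewrite /alternant /determinant; apply: eq_bigr => w _.
rewrite -[RHS]mul_mpolyC rmorphXn rmorphN rmorph1; congr (_ * _).
rewrite mpolyXE_id; apply: eq_bigr => i _.
by rewrite mxE !mnmE.
Qed.

Lemma mcoeff_alternant N (s : seq nat) v :
  (alternant R N s)@_v =
  \sum_(w : 'S_N) (-1) ^+ w * ((mnm_of N s + stair N)%MM # w == v)%:R.
Proof.
rewrite alternantE raddf_sum /=; apply: eq_bigr => w _.
by rewrite mcoeffZ mcoeffX.
Qed.

Lemma parts_nth_geq (la : intpart) i j : (i <= j)%N -> (nth 0 la j <= nth 0 la i)%N.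
Proof.
move=> ij; have [jl|/(nth_default 0%N) ->] // := ltnP j (size la).
have rf : reflexive geq by move=> x; apply: leqnn.
apply: (sorted_leq_nth geq_trans rf _ (parts_sorted la)) => //.
exact: leq_ltn_trans ij jl.
Qed.

Lemma strict_stair N (la : intpart) : strict (mnm_of N la + stair N).
Proof.
move=> i j ij; rewrite !mnmDE !mnmE.
by have := parts_nth_geq la (ltnW ij); have := ltn_ord i; have := ltn_ord j; lia.
Qed.

Lemma strict_sorted N (v : 'X_{1..N}) : strict v -> sorted geq v.
Proof.
move=> sv; apply/(sortedP 0%N) => i; rewrite size_tuple => iN.
rewrite -(mnm_nth 0%N v (Ordinal iN)) -(mnm_nth 0%N v (Ordinal (ltnW iN))) /=.
by apply/ltnW/sv => /=.
Qed.

Lemma strict_inj N (v : 'X_{1..N}) : strict v -> injective v.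
Proof.
move=> sv i j ij; apply/val_inj => /=.
by case: (ltngtP i j) => // /sv; rewrite ij ltnn.
Qed.

(** Sorting determines both the exponent and the permutation. *)
Lemma strict_perm N (v u : 'X_{1..N}) (w : 'S_N) :
  strict v -> strict u -> v # w = u -> w = 1%g.
Proof.
move=> sv su vu; have E : v = u.
  apply/val_inj/val_inj => /=.
  apply: (sorted_eq geq_trans geq_anti (strict_sorted sv) (strict_sorted su)).
  by rewrite -vu perm_sym; apply: mnm_perm.
apply/permP => i; rewrite perm1; apply: (strict_inj sv).
by move/mnmP/(_ i): vu; rewrite mnmE -E.
Qed.

Lemma mcoeff_alternant_stair N (la mu : intpart) :
  (alternant R N la)@_(mnm_of N mu + stair N) = (mnm_of N la == mnm_of N mu)%:R.
Proof.
rewrite mcoeff_alternant (bigD1 1%g) //= big1 ?addr0.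
  rewrite odd_perm1 mul1r; congr (_%:R); congr nat_of_bool.
  by rewrite mperm1 (inj_eq (@addIm _ (stair N))).
move=> w nw; case: eqP => [E|]; rewrite ?mulr0 //.
by case/eqP: nw; apply: (strict_perm _ _ E); apply: strict_stair.
Qed.

Definition antisymmetric_mpoly N (p : {mpoly C[N]}) :=
  forall (w : 'S_N) v, p@_(v # w) = (-1) ^+ w * p@_v.

Lemma antisymmetric_alternant N s : antisymmetric_mpoly (alternant R N s).
Proof.
move=> w v; rewrite !mcoeff_alternant (reindex_inj (mulgI w)) mulr_sumr /=.
apply: eq_bigr => u _; rewrite mulrA odd_permM signr_addb; congr (_ * _).
congr (_%:R); congr nat_of_bool; set b := (_ + _)%MM.
have -> : b # (w * u)%g = (b # u) # w.
  by apply/mnmP => i; rewrite !mnmE permM.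
by rewrite (inj_eq (@mperm_inj _ w)).
Qed.

Lemma antisymmetric_mulr N (p q : {mpoly C[N]}) :
  q \is symmetric -> antisymmetric_mpoly p -> antisymmetric_mpoly (p * q).
Proof.
move=> /issymP sq ap w v; rewrite -mcoeff_sym rmorphM /= sq.
have -> : msym w p = (-1) ^+ w *: p.
  by apply/mpolyP => u; rewrite mcoeff_sym mcoeffZ ap.
by rewrite -scalerAl mcoeffZ.
Qed.

Lemma antisymmetric_sumZ N (I : finType) (c : I -> C) (p : I -> {mpoly C[N]}) :
  (forall i, antisymmetric_mpoly (p i)) ->
  antisymmetric_mpoly (\sum_i c i *: p i).
Proof.
move=> H w v; rewrite !raddf_sum mulr_sumr /=; apply: eq_bigr => i _.
by rewrite !mcoeffZ H mulrCA.
Qed.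

Lemma mnm_of_part_of N (v : 'X_{1..N}) : sorted geq v -> mnm_of N (part_of v) = v.
Proof.
move=> sv; have [s vE] := mnm_sort v; apply/val_inj/val_inj => /=.
have sm : sorted geq (mnm_of N (part_of v)).
  apply/(sortedP 0%N) => i; rewrite size_tuple => iN.
  rewrite -(mnm_nth 0%N _ (Ordinal iN)) -(mnm_nth 0%N _ (Ordinal (ltnW iN))) !mnmE.
  exact: parts_nth_geq.
apply: (sorted_eq geq_trans geq_anti sm sv).
by rewrite perm_sym {1}vE; apply: mnm_perm.
Qed.

(** Each entry of a strictly decreasing exponent is at least that of the
    staircase, and the difference is weakly decreasing. *)
Lemma strict_decomp N (u : 'X_{1..N}) : strict u ->
  exists2 mu : intpart, (size mu <= N)%N & u = (mnm_of N mu + stair N)%MM.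
Proof.
move=> su; pose t : 'X_{1..N} := [multinom u i - (N - i.+1) | i < N].
have ub k (i : 'I_N) : (i + k.+1)%N = N -> (k <= u i)%N.
  elim: k i => // k IH i ik.
  have iN : (i.+1 < N)%N by lia.
  apply: leq_ltn_trans (IH (Ordinal iN) _) (su i (Ordinal iN) _) => //=; lia.
have st : sorted geq t.
  apply/(sortedP 0%N) => i; rewrite size_tuple => iN.
  rewrite -(mnm_nth 0%N _ (Ordinal iN)) -(mnm_nth 0%N _ (Ordinal (ltnW iN))) !mnmE.
  have := su (Ordinal (ltnW iN)) (Ordinal iN) (leqnn _); rewrite /=; lia.
exists (part_of t); first exact: size_part_of_mnm.
rewrite mnm_of_part_of //; apply/mnmP => i; rewrite mnmDE !mnmE subnK //.
by apply: ub; have := ltn_ord i; lia.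
Qed.

Lemma injective_strict N (v : 'X_{1..N}) : injective v ->
  exists w : 'S_N, strict (v # w).
Proof.
move=> vI; have [s vE] := mnm_sort v; set b := mnm_of _ _ in vE.
exists (s^-1)%g; have -> : v # s^-1%g = b.
  by rewrite vE; apply/mnmP => i; rewrite !mnmE permKV.
move=> i j ij; have bI : b i != b j.
  have bs k : b k = v (s^-1 k)%g by rewrite vE mnmE permKV.
  by rewrite !bs (inj_eq vI) (inj_eq perm_inj) neq_ltn ij.
by move: bI; rewrite !mnmE; have := parts_nth_geq (part_of v) (ltnW ij); lia.
Qed.

(** An exponent with a repeated entry is fixed by a transposition, which negates
    its coefficient; any other exponent can be sorted into some [mu + delta]. *)
Lemma antisymmetric_eq0 N (p : {mpoly C[N]}) : antisymmetric_mpoly p ->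
  (forall mu : intpart, (size mu <= N)%N -> p@_(mnm_of N mu + stair N) = 0) ->
  p = 0.
Proof.
move=> ap H; apply/mpolyP => v; rewrite mcoeff0.
have [/injectiveP vI|/injectivePn[i [j ij vij]]] := boolP (injectiveb v).
  have [w /strict_decomp[mu sm E]] := injective_strict vI.
  have := ap w v; rewrite E H // => /esym/eqP.
  by rewrite mulf_eq0 signr_eq0 /= => /eqP.
have := ap (tperm i j) v; rewrite odd_tperm ij expr1 mulN1r.
have -> : v # tperm i j = v.
  by apply/mnmP => k; rewrite mnmE; case: tpermP => [->|->|].
move=> /eqP; rewrite -subr_eq0 opprK -mulr2n mulrn_eq0 /=.
by move/eqP.
Qed.

(** With [delta] the staircase, [nth 0 mu i + w i - i] is the entry [i] of
    [mu + delta - w delta]; the difference of exponents makes sense when no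
    truncation occurs. *)
Definition shiftable N (mu : seq nat) (w : 'S_N) :=
  [forall i : 'I_N, i <= nth 0 mu i + w i]%N.

Definition shift_mnm N (mu : seq nat) (w : 'S_N) : 'X_{1..N} :=
  [multinom nth 0%N mu i + w i - i | i < N].

Arguments shift_mnm : simpl never.

(** The entry of the inverse Kostka matrix, that is, the coefficient of [s_mu]
    in [m_la], read off in [N] variables as the coefficient of [x^(mu + delta)]
    in [a_delta m_la]. *)
Definition inv_kostka N (la mu : intpart) : C :=
  \sum_(w : 'S_N) (-1) ^+ w *
    (shiftable mu w && (part_of (shift_mnm mu w) == la))%:R.

Lemma mcoeff_alternant_monomial N (la mu : intpart) :
  (alternant R N [::] * monomial R la N)@_(mnm_of N mu + stair N) = inv_kostka N la mu.
Proof.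
rewrite alternantE mulr_suml raddf_sum /=; apply: eq_bigr => w _.
rewrite -scalerAl mcoeffZ mcoeff_mulX; congr (_ * _).
have mN (i : 'I_N) := ltn_ord i.
have -> : ((mnm_of N [::] + stair N)%MM # w <= mnm_of N mu + stair N)%MM = shiftable mu w.
  apply/mnm_lepP/forallP => H i; have := H i; rewrite !mnmE nth_nil;
    have := mN i; have := mN (w i); lia.
case: (boolP (shiftable mu w)) => //= /forallP sh.
rewrite mcoeff_monomial; set v := (_ - _)%MM.
suff -> : v = shift_mnm mu w by [].
apply/mnmP => i; rewrite !mnmE nth_nil.
have := sh i; have := mN i; have := mN (w i); lia.
Qed.

Lemma sum_ord_perm N (w : 'S_N) (F : nat -> nat) : (\sum_(i < N) F (w i) = \sum_(i < N) F i)%N.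
Proof. by rewrite [RHS](reindex_perm w). Qed.

Lemma mdeg_shift_mnm N (mu : intpart) (w : 'S_N) : (size mu <= N)%N ->
  shiftable mu w -> mdeg (shift_mnm mu w) = psize mu.
Proof.
move=> sN /forallP sh; apply/eqP; rewrite -(eqn_add2r (\sum_(i < N) i)).
rewrite mdegE -big_split /= -(mdeg_mnm_of sN) mdegE -[X in (_ + X)%N](sum_ord_perm w id).
rewrite -big_split /=; apply/eqP; apply: eq_bigr => i _; rewrite !mnmE.
by have := sh i; lia.
Qed.

Lemma inv_kostka_psize N (la mu : intpart) : (size mu <= N)%N ->
  inv_kostka N la mu != 0 -> psize mu = psize la.
Proof.
move=> sN; apply: contraNeq => ne; rewrite /inv_kostka big1 // => w _.
case: andP => [[sh /eqP E]|]; rewrite ?mulr0 //; case/eqP: ne.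
by rewrite -E psize_part_of_mnm (mdeg_shift_mnm sN sh).
Qed.

Lemma perm_fix_max N (s : 'S_N.+1) : s ord_max = ord_max ->
  exists t : 'S_N, s = lift_perm ord_max ord_max t.
Proof.
move=> sm; have ne k : ord_max != s (lift ord_max k).
  by rewrite -{1}sm (inj_eq perm_inj) neq_lift.
have ex k : exists j, s (lift ord_max k) = lift ord_max j.
  by case: (unliftP ord_max (s (lift ord_max k))) (ne k) => [j ->|->]; [exists j|rewrite eqxx].
have [f fP] := fin_all_exists ex.
have fI : injective f.
  by move=> k l /(congr1 (lift ord_max)); rewrite -!fP => /perm_inj/lift_inj.
exists (perm fI); apply/permP => i; case: (unliftP ord_max i) => [j|] ->.
  by rewrite lift_perm_lift permE fP.
by rewrite lift_perm_id.
Qed.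

Lemma lift_perm_max_inj N : injective (@lift_perm N ord_max ord_max).
Proof.
move=> s t st; apply/permP => i; apply: (@lift_inj _ ord_max).
by rewrite -!(lift_perm_lift ord_max ord_max) st.
Qed.

(** Since the last part of [mu] in [N.+1] variables is zero, the permutations
    that contribute fix the last index. *)
Lemma inv_kostkaS N (la mu : intpart) : (size mu <= N)%N ->
  inv_kostka N.+1 la mu = inv_kostka N la mu.
Proof.
move=> sN; have mu0 : nth 0%N mu N = 0%N by rewrite nth_default.
have lm (k : 'I_N) : nat_of_ord (lift (@ord_max N) k) = k by apply: lift_max.
pose F (w : 'S_N.+1) : C := (-1) ^+ w *
  (shiftable mu w && (part_of (shift_mnm mu w) == la))%:R.
rewrite -[LHS]/(\sum_w F w).
rewrite (bigID (fun w : 'S_N.+1 => w \in lift_perm ord_max ord_max @: predT)) /=.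
rewrite [X in _ + X]big1 ?addr0; last first.
  move=> w nw; rewrite /F.
  case: (boolP (shiftable mu w)) => [/forallP/(_ ord_max)|]; rewrite ?mulr0 //=.
  rewrite mu0 add0n => le; case/imsetP: nw.
  have [|t ->] := @perm_fix_max _ w; last by exists t.
  by apply/val_inj/eqP; rewrite /= eqn_leq le andbT -ltnS ltn_ord.
rewrite big_imset /=; last by move=> s t _ _; apply: lift_perm_max_inj.
apply: eq_bigr => w _; rewrite /F odd_lift_perm addbb addFb; congr (_ * _).
have -> : shiftable mu (lift_perm ord_max ord_max w) = shiftable mu w.
  apply/forallP/forallP => H i; last first.
    case: (unliftP ord_max i) => [j|] ->; last by rewrite lift_perm_id leq_addl.
    by rewrite lift_perm_lift !lift_max.
  by have := H (lift ord_max i); rewrite lift_perm_lift !lift_max.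
suff -> : shift_mnm mu (lift_perm ord_max ord_max w) = mnmwiden (shift_mnm mu w).
  by rewrite part_of_mnmwiden.
apply/mnmP => i; case: (unliftP ord_max i) => [j|] ->.
  rewrite mnmE lift_perm_lift !lm.
  by rewrite -widen_lift_max mnmwiden_widen mnmE.
by rewrite mnmwiden_ordmax mnmE lift_perm_id /= mu0 addnK.
Qed.

Lemma inv_kostka_widen N M (la mu : intpart) : (size mu <= N)%N -> (N <= M)%N ->
  inv_kostka M la mu = inv_kostka N la mu.
Proof.
move=> sN /subnKC <-; elim: (M - N)%N => [|k IH]; first by rewrite addn0.
by rewrite addnS inv_kostkaS ?IH // (leq_trans sN) ?leq_addr.
Qed.

Definition schur_coef : pmat C := fun n a b => inv_kostka n a b.

(** The product of the Schur polynomial with [a_delta], which vanishes when the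
    partition has too many parts. *)
Definition alternant_part N (la : intpart) : {mpoly C[N]} :=
  if (size la <= N)%N then alternant R N la else 0.

(** Both sides are antisymmetric, so their coefficients are compared at the
    exponents [mu + delta], where the alternants are dual to each other. *)
Lemma alternant_monomial n (a : intpartn n) N :
  alternant R N [::] * monomial R a N =
  \sum_b schur_coef a b *: alternant_part N b.
Proof.
apply/eqP; rewrite -subr_eq0; apply/eqP/antisymmetric_eq0.
  move=> w v; rewrite !mcoeffB mulrBr; congr (_ - _).
    apply: antisymmetric_mulr; last exact: antisymmetric_alternant.
    by have [] := Lambda_monomial R a N.
  apply: antisymmetric_sumZ => b; rewrite /alternant_part.
  case: ifP => _; first exact: antisymmetric_alternant.
  by move=> u x; rewrite !mcoeff0 mulr0.
move=> mu sN; rewrite mcoeffB mcoeff_alternant_monomial raddf_sum /=.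
have E (b : intpartn n) : (schur_coef a b *: alternant_part N b)@_(mnm_of N mu + stair N)
    = schur_coef a b * (mu == b)%:R.
  rewrite mcoeffZ /alternant_part; congr (_ * _).
  case: (leqP (size b) N) => bN; last first.
    rewrite mcoeff0; case: eqP => // E; move: bN; rewrite -E ltnNge sN //.
  rewrite mcoeff_alternant_stair; congr (_%:R); congr nat_of_bool.
  apply/eqP/eqP => [E|-> //].
  by rewrite -(part_of_mnm_of sN) -E part_of_mnm_of.
rewrite (eq_bigr _ (fun b _ => E b)) => {E}.
have [mun|mun] := eqVneq (psize mu) n.
  have [b Eb] := intpartn_of mun.
  rewrite (bigD1 b) //= -Eb eqxx mulr1 big1 ?addr0; last first.
    move=> c cb; case: eqP => [mc|]; rewrite ?mulr0 //.
    by case/eqP: cb; apply/val_inj; rewrite /= -mc.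
  rewrite Eb.
  have sn : (size mu <= n)%N by rewrite -mun size_le_psize.
  have NE : inv_kostka N a mu = inv_kostka n a mu.
    by case/orP: (leq_total n N) => h; [|apply/esym]; apply: inv_kostka_widen.
  by rewrite NE /schur_coef Eb subrr.
rewrite big1 => [|b _]; last first.
  by case: eqP => [Eb|]; rewrite ?mulr0 //; move: mun; rewrite Eb psizeE eqxx.
rewrite subr0; apply: contra_neq_eq mun => /(inv_kostka_psize sN) ->.
by rewrite psizeE.
Qed.

(** The index sets on both sides have [k] elements.  Outside their intersection
    the indices on the left are smaller than [k], those on the right are not. *)
Lemma sum_ord_min N (w : 'S_N) k : (k <= N)%N ->
  (\sum_(i < N | i < k) i <= \sum_(i < N | i < k) w i)%N.
Proof.
move=> kN; pose K := [set i : 'I_N | (i < k)%N]; pose B := w @: K.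
have cB : #|B| = #|K| by rewrite card_imset //; apply: perm_inj.
have -> : (\sum_(i < N | i < k) w i = \sum_(i in B) i)%N.
  rewrite big_imset /=; last by move=> i j _ _; apply: perm_inj.
  by apply: eq_bigl => i; rewrite inE.
have -> : (\sum_(i < N | i < k) i = \sum_(i in K) i)%N.
  by apply: eq_bigl => i; rewrite inE.
rewrite (big_setID B) /= [X in (_ <= X)%N](big_setID K) /= finset.setIC leq_add2l.
have c : #|K :\: B| = #|B :\: K|.
  by apply/eqP; rewrite -(eqn_add2l #|K :&: B|) cardsID finset.setIC cardsID cB.
apply: (@leq_trans (#|K :\: B| * k)).
  by rewrite -sum_nat_const; apply: leq_sum => i; rewrite !inE => /andP[_ /ltnW].
rewrite c -sum_nat_const; apply: leq_sum => i; rewrite !inE -leqNgt.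
by case/andP.
Qed.

Lemma shift_mnm_sum N (mu : intpart) (w : 'S_N) k : (k <= N)%N -> shiftable mu w ->
  (\sum_(i < N | i < k) nth 0 mu i <= \sum_(i < N | i < k) shift_mnm mu w i)%N.
Proof.
move=> kN /forallP sh; rewrite -(leq_add2r (\sum_(i < N | (i < k)%N) w i)) -big_split /=.
have -> : (\sum_(i < N | i < k) (nth 0 mu i + w i) =
    \sum_(i < N | i < k) shift_mnm mu w i + \sum_(i < N | i < k) i)%N.
  rewrite -big_split /=; apply: eq_bigr => i _; rewrite mnmE.
  by rewrite subnK // sh.
by rewrite leq_add2l sum_ord_min.
Qed.

Lemma sumn_take_ord (s : seq nat) N k : (k <= N)%N ->
  sumn (take k s) = (\sum_(i < N | i < k) nth 0 s i)%N.
Proof.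
move=> kN; rewrite (big_ord_narrow kN) /=.
elim: k {kN} => [|k IH]; first by rewrite take0 big_ord0.
by rewrite sumn_takeS big_ord_recr /= IH.
Qed.

Lemma shift_mnm_dominated n (b : intpartn n) (w : 'S_n) k : (k <= n)%N ->
  shiftable b w ->
  (sumn (take k b) <= \sum_(i < n | i < k) shift_mnm b w i
     <= sumn (take k (part_of (shift_mnm b w))))%N.
Proof.
move=> kn sh; rewrite (sumn_take_ord _ kn) shift_mnm_sum //=.
have := sum_subset_dominated (shift_mnm b w) [set i : 'I_n | (i < k)%N].
have -> : #|[set i : 'I_n | (i < k)%N]| = k.
  by rewrite -sum1dep_card (big_ord_narrow kn) /= sum1_card card_ord.
by apply: leq_trans; rewrite leq_eqVlt; apply/orP; left; apply/eqP;
  apply: eq_bigl => i; rewrite inE.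
Qed.

(** By the two bounds of [shift_mnm_dominated], the partial sums
    of [mu + delta - w delta] lie between those of [mu] and those of its
    decreasing rearrangement. *)
Lemma schur_coef_dominated n (a b : intpartn n) :
  schur_coef a b != 0 -> dominated b a.
Proof.
move=> nz; have [w [sh /eqP E]] : exists w : 'S_n, shiftable b w /\ part_of (shift_mnm b w) == a.
  apply: contrapT => H; move: nz; rewrite /schur_coef /inv_kostka big1 ?eqxx // => w _.
  by case: andP => [[sh E]|]; rewrite ?mulr0 //; case: H; exists w.
move=> k; have [kn|nk] := leqP k n.
  by have /andP[h1 h2] := shift_mnm_dominated kn sh; rewrite -E (leq_trans h1).
by rewrite !take_oversize ?(leq_trans (size_intpartn _)) ?(ltnW nk) // -!/(psize _) !psizeE.
Qed.

(** When the rearrangement is [a] itself, all partial sums agree, hence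
    [a + delta - w delta = a]: only the identity contributes. *)
Lemma schur_coef_diag n (a : intpartn n) : schur_coef a a != 0.
Proof.
pose F (w : 'S_n) : C := (-1) ^+ w *
  (shiftable a w && (part_of (shift_mnm a w) == a))%:R.
rewrite -[schur_coef a a]/(\sum_w F w) (bigD1 1%g) //= big1 ?addr0; last first.
  move=> w nw; rewrite /F; case: andP => [[sh /eqP E]|]; rewrite ?mulr0 //; case/eqP: nw.
  have H k : (k <= n)%N -> (\sum_(i < n | i < k) nth 0 a i = \sum_(i < n | i < k) shift_mnm a w i)%N.
    move=> kn; have := shift_mnm_dominated kn sh; rewrite E (sumn_take_ord _ kn).
    by move=> h; apply/eqP; rewrite eqn_leq.
  have step (G : 'I_n -> nat) (i : 'I_n) :
      (\sum_(j < n | j < i.+1) G j = \sum_(j < n | j < i) G j + G i)%N.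
    rewrite (bigD1 i) //= addnC; congr (_ + _)%N; apply: eq_bigl => j.
    by rewrite ltnS [RHS]ltn_neqAle andbC.
  apply/permP => i; rewrite perm1; apply/val_inj => /=.
  have := H i.+1 (ltn_ord i); rewrite !step (H i (ltnW (ltn_ord i))) mnmE.
  by have /forallP/(_ i) := sh; lia.
rewrite /F; have -> : shiftable a (1 : 'S_n)%g.
  by apply/forallP => i; rewrite perm1 leq_addl.
have -> : shift_mnm a (1 : 'S_n)%g = mnm_of n a.
  by apply/mnmP => i; rewrite !mnmE perm1 addnK.
by rewrite part_of_intpartn eqxx odd_perm1 mulr1 oner_eq0.
Qed.

Lemma mnm_cons N (v : 'X_{1..N.+1}) :
  v = v ord0 :: [multinom v (lift ord0 j) | j < N] :> seq nat.
Proof.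
rewrite (mnm_seqE v) (mnm_seqE [multinom _ | _ < _]) enum_ordSl /= -map_comp.
by congr (_ :: _); apply: eq_map => j /=; rewrite mnmE.
Qed.

(** The hypotheses make [x] at least [|la|], hence at least every part of the
    tail [la], so that it can only match the first part of [la[n]]. *)
Lemma part_of_pad_seq (x : nat) (t : seq nat) (la mu a : intpart) n :
  (psize la <= psize mu)%N -> (2 * psize mu <= n)%N -> (n - psize mu <= x)%N ->
  parts a = pad_seq la n ->
  (part_of (x :: t) == a) = (x == n - psize la)%N && (part_of t == la).
Proof.
move=> lm mn nx Ea; rewrite -!perm_part_of Ea.
have [n0|n0] := posnP n.
  have l0 : psize la = 0%N by lia.
  have {}l0 : parts la = [::].
    by apply/eqP; rewrite -size_eq0 -leqn0 -l0 size_le_psize.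
  rewrite n0 sub0n /pad_seq l0; case: x {nx} => [|x] //=.
  by apply/negP => /perm_size.
have -> : pad_seq la n = (n - psize la)%N :: la by rewrite /pad_seq; case: n n0 {Ea mn nx}.
have x0 : x != 0%N.
  by case: eqP nx => // ->; lia.
rewrite /= x0; case: eqP => [->|xn] /=; first by rewrite perm_cons.
apply/negP => /perm_mem/(_ x); rewrite mem_head inE => /esym/orP[/eqP//|].
by move=> /(nthP 0%N)[i _ E]; have := nth_le_psize la i; rewrite E; lia.
Qed.

(** Only the first entry [n - |mu| + w 0] of [mu[n] + delta - w delta] involves
    [n].  By [part_of_pad_seq] it equals [n - |la|], so the condition on [w]
    involves the tails only. *)
Lemma schur_coef_stable : pad_stable schur_coef 0.
Proof.
have key (la mu : intpart) n N : (psize la <= psize mu)%N ->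
    (2 * psize mu <= n)%N -> (n <= N.+1)%N ->
    pad_entry schur_coef la mu n = \sum_(w : 'S_N.+1) (-1) ^+ w *
      ([forall j : 'I_N, lift ord0 j <= nth 0 mu j + w (lift ord0 j)]%N &&
       ((w ord0 + psize la == psize mu)%N &&
       (part_of [multinom nth 0 mu j + w (lift ord0 j) - lift ord0 j | j < N]%N == la)))%:R.
  move=> lm nm nN; rewrite /pad_entry.
  have [a Ea] := pad_defined lm nm.
  have [b Eb] := pad_defined (leqnn _) nm.
  rewrite Ea Eb /schur_coef -(inv_kostka_widen a (size_intpartn b) nN).
  have [hb Ebs] := pad_Some Eb; have [ha Eas] := pad_Some Ea.
  have mun := pad_psize Eb.
  have b0 : nth 0%N b 0 = (n - psize mu)%N by rewrite Ebs pad_seq0.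
  have bS i : nth 0%N b i.+1 = nth 0%N mu i by rewrite Ebs pad_seqS.
  apply: eq_bigr => w _; congr (_ * _).
  have -> : shiftable b w = [forall j : 'I_N,
      lift ord0 j <= nth 0 mu j + w (lift ord0 j)]%N.
    apply/forallP/forallP => H i.
      by have := H (lift ord0 i); rewrite [in nth _ _ (lift _ _)]lift0 bS.
    case: (unliftP ord0 i) => [j|] -> //.
    by rewrite [in nth _ _ (lift _ _)]lift0 bS.
  rewrite mnm_cons (part_of_pad_seq _ lm nm _ Eas); last first.
    by rewrite mnmE /= b0 subn0 leq_addr.
  have -> : (shift_mnm b w ord0 == n - psize la)%N = (w ord0 + psize la == psize mu)%N.
    by rewrite mnmE /= b0; apply/eqP/eqP; lia.
  suff -> : [multinom shift_mnm b w (lift ord0 j) | j < N] =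
    [multinom nth 0 mu j + w (lift ord0 j) - lift ord0 j | j < N]%N by [].
  apply/mnmP => j.
  by rewrite !mnmE [in nth _ _ (lift _ _)]lift0 bS.
move=> la mu lm n nm; rewrite addn0 in nm *.
by rewrite (key _ _ _ n) // ?leqW // [RHS](key _ _ _ n) // leqW.
Qed.

Lemma alternant0_neq0 N : alternant R N [::] != 0.
Proof.
have e0 : is_part [::] by [].
apply/eqP => /(congr1 (mcoeff (mnm_of N (IntPart e0) + stair N))).
rewrite -[[::]]/(parts (IntPart e0)) mcoeff_alternant_stair eqxx mcoeff0.
by move/eqP; rewrite oner_eq0.
Qed.

Lemma schur_unique N (la : intpart) (q : {mpoly C[N]}) :
  q * alternant R N [::] = alternant_part N la -> schur R la N = q.
Proof.
rewrite /schur /alternant_part; case: ifP => _ qE.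
  case: xgetP => [p _ pE|/(_ q)//].
  by apply: (mulIf (alternant0_neq0 N)); rewrite pE.
by move/eqP: qE; rewrite mulf_eq0 (negPf (alternant0_neq0 N)) orbF => /eqP.
Qed.

(** Inverting [alternant_monomial] exhibits each alternant as a multiple of
    [a_delta], which proves that the Schur polynomials exist. *)
Lemma schur_expands Y : inverses Y schur_coef ->
  expands (schur R) (monomial R) Y.
Proof.
move=> YX n b N; apply: schur_unique; rewrite mulr_suml.
under eq_bigr => a _.
  rewrite -scalerAl mulrC alternant_monomial scaler_sumr; over.
rewrite exchange_big /=.
have E c : \sum_a Y n b a *: (schur_coef a c *: alternant_part N c)
    = (b == c)%:R *: alternant_part N c.
  by rewrite -YX scaler_suml; apply: eq_bigr => a _; rewrite scalerA.
rewrite (eq_bigr _ (fun c _ => E c)) (bigD1 b) //= eqxx scale1r.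
by rewrite big1 ?addr0 // => c /negPf; rewrite eq_sym => ->; rewrite scale0r.
Qed.

(** * The Jacobi-Trudi identity *)

(** This is the polynomial [h_k] in the variables of index in [S] alone. *)
Definition complete_on N (S : {set 'I_N}) k : {mpoly C[N]} :=
  \sum_(m : 'X_{1..N < k.+1} |
     (mdeg m == k) && [forall i, (i \in S) || (m i == 0%N)]) 'X_[m].

Lemma mcoeff_complete_on N (S : {set 'I_N}) k (v : 'X_{1..N}) :
  (complete_on S k)@_v =
  ((mdeg v == k) && [forall i, (i \in S) || (v i == 0%N)])%:R.
Proof.
rewrite /complete_on raddf_sum /=.
under eq_bigr => m _ do rewrite mcoeffX.
have [E|E] := boolP ((mdeg v == k) && [forall i, (i \in S) || (v i == 0%N)]); last first.
  rewrite big1 // => m mk; case: eqP => // mv; by rewrite -mv mk in E.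
have lt : (mdeg v < k.+1)%N by case/andP: E => /eqP ->.
rewrite (bigD1 (BMultinom lt)) /= ?E ?eqxx // big1 ?addr0 //.
by move=> m /andP[_ nm]; case: eqP => // mv; case/eqP: nm; apply/val_inj.
Qed.

Lemma complete_onT N k : complete_on [set: 'I_N] k = complete1 R k N.
Proof.
apply/mpolyP => v; rewrite mcoeff_complete_on mcoeff_complete1.
by rewrite (_ : [forall i, _]) ?andbT //; apply/forallP => i; rewrite inE.
Qed.

Lemma complete_on1 N (i : 'I_N) k : complete_on [set i] k = 'X_i ^+ k.
Proof.
apply/mpolyP => v; rewrite mcoeff_complete_on mcoeffXn; congr (_%:R); congr nat_of_bool.
apply/andP/eqP => [[/eqP vk /forallP H]|<-].
  have z j : j != i -> v j = 0%N.
    by move=> ji; have := H j; rewrite inE (negPf ji) => /eqP.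
  apply/mnmP => j; rewrite mulmnE mnm1E; case: eqP => [<-|ij].
    by rewrite mul1n -vk mdegE (bigD1 i) //= big1 ?addn0.
  by rewrite z //; apply/eqP => ji; case: ij.
rewrite mdegMn mdeg1 mul1n; split=> //; apply/forallP => j.
rewrite inE mulmnE mnm1E eq_sym; by case: eqP.
Qed.

Lemma complete_onD1 N (S : {set 'I_N}) i k : i \in S ->
  complete_on (S :\ i) k =
  complete_on S k - (if k is k'.+1 then 'X_i * complete_on S k' else 0).
Proof.
move=> iS; apply/eqP; rewrite eq_sym subr_eq eq_sym; apply/eqP/mpolyP => v.
have Hi : [forall j, (j \in S :\ i) || (v j == 0%N)] =
    [forall j, (j \in S) || (v j == 0%N)] && (v i == 0%N).
  apply/forallP/andP => [H|[/forallP H vi] j].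
    split; last by have := H i; rewrite !inE eqxx.
    by apply/forallP => j; have := H j; rewrite !inE; case: (j == i); case: (j \in S).
  by rewrite !inE; have [->|_] := eqVneq j i; [rewrite vi orbT|apply: H].
rewrite mcoeffD !mcoeff_complete_on Hi.
case: k => [|k].
  rewrite mcoeff0 addr0; congr (_%:R); congr nat_of_bool.
  case: eqP => //= v0; rewrite (_ : v i == 0%N) ?andbT //.
  by rewrite -leqn0 -v0 mnm_le_mdeg.
rewrite -['X_i]expr1 mcoeff_mul_pow mcoeff_complete_on mulm1n.
have [vi|vi] := posnP (v i); first by rewrite andbT addr0.
rewrite !andbF add0r; congr (_%:R); congr nat_of_bool; congr (_ && _).
  have := @mdeg_subU _ v i 1 vi; rewrite mulm1n => ->.
  by have h := mnm_le_mdeg v i; apply/eqP/eqP; lia.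
apply/forallP/forallP => H j; have := H j; rewrite mnmBE mnm1E.
  case: (eqVneq i j) => [<-|_]; first by rewrite iS.
  by rewrite subn0.
by case/orP => [->//|/eqP ->]; rewrite sub0n orbT.
Qed.

(** Multiplying the generating function of the complete homogeneous polynomials
    by [1 - x_i t] removes the variable [x_i].  Removing all variables but one
    expresses the powers of that one by a recurrence of length [N], whose
    coefficients do not depend on the exponent. *)
Lemma complete_on_remove N (T : {set 'I_N}) :
  exists c : nat -> {mpoly C[N]}, forall k,
    complete_on (~: T) k =
    \sum_(j < #|T|.+1) c j * (if (j <= k)%N then complete1 R (k - j) N else 0).
Proof.
elim: {T}#|T| {-2}T (erefl #|T|) => [|n IH] T cT.
  exists (fun=> 1) => k; rewrite cT big_ord1 subn0 mul1r.
  have /eqP -> : T == finset.set0 by rewrite -cards_eq0 cT.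
  by rewrite finset.setC0 complete_onT.
have [i iT] : exists i, i \in T by apply/card_gt0P; rewrite cT.
have cT' : #|T :\ i| = n by have := cardsD1 i T; rewrite iT cT => -[].
have [c cP] := IH _ cT'; rewrite cT' in cP.
exists (fun j => (if (j < n.+1)%N then c j else 0) -
                 (if j is j'.+1 then 'X_i * c j' else 0)) => k; rewrite cT.
have -> : ~: T = (~: (T :\ i)) :\ i.
  by apply/setP => j; rewrite !inE; case: eqP => [->|]; rewrite ?iT.
rewrite complete_onD1; last by rewrite !inE eqxx.
under [RHS]eq_bigr => j _ do rewrite mulrBl.
rewrite sumrB; congr (_ - _).
  rewrite cP [RHS]big_ord_recr /= ltnn mul0r addr0.
  by apply: eq_bigr => j _; rewrite ltn_ord.
rewrite big_ord_recl /= mul0r add0r.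
case: k => [|k]; first by rewrite big1 // => j _; rewrite mulr0.
rewrite cP mulr_sumr; apply: eq_bigr => j _.
by rewrite mulrA /bump leq0n add1n ltnS subSS.
Qed.

(** The entry [(k, j)] is [h_(la_j - j + k)], which is zero for a negative
    index. *)
Definition jacobi_trudi N (la : intpart) : 'M[{mpoly C[N]}]_N :=
  \matrix_(k, j) (if (j <= nth 0 la j + k)%N
                  then complete1 R (nth 0 la j + k - j)%N N else 0).

(** The recurrences of [complete_on_remove] factor the matrix of the powers
    [x_i^(la_j + N - 1 - j)] through a matrix that does not depend on [la]. *)
Lemma alternant_factor N : exists A : 'M[{mpoly C[N]}]_N,
  forall la : intpart, alternant R N la = \det A * \det (jacobi_trudi N la).
Proof.
have H (i : 'I_N) : exists c : nat -> {mpoly C[N]}, forall k,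
    'X_i ^+ k = \sum_(j < N) c j * (if (j <= k)%N then complete1 R (k - j) N else 0).
  have cN : #|[set~ i]|.+1 = N.
    by rewrite cardsC1 card_ord prednK // (leq_ltn_trans _ (ltn_ord i)).
  have [c cP] := complete_on_remove [set~ i]; rewrite cN in cP; exists c => k.
  by rewrite -complete_on1 -[in LHS](finset.setCK [set i]) cP.
have [c cP] := fin_all_exists H.
exists (\matrix_(i, k) c i (N - k.+1)%N) => la.
rewrite -det_mulmx; congr (\det _); apply/matrixP => i j; rewrite !mxE cP.
rewrite (reindex_inj rev_ord_inj) /=; apply: eq_bigr => k _; rewrite !mxE.
congr (_ * _); have := ltn_ord j; have := ltn_ord k => kN jN.
have -> : (N - k.+1 <= nth 0 la j + (N - j.+1))%N = (j <= nth 0 la j + k)%N.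
  by apply/idP/idP; lia.
case: ifP => // h; congr (complete1 R _ N); lia.
Qed.

Lemma det_jacobi_trudi0 N (la : intpart) : parts la = [::] -> \det (jacobi_trudi N la) = 1.
Proof.
move=> la0; rewrite det_trig; last first.
  apply/is_trig_mxP => i j ij; rewrite mxE la0 nth_nil add0n.
  by rewrite leqNgt ij.
rewrite big1 // => i _; rewrite mxE la0 nth_nil add0n leqnn subnn.
by apply/mpolyP => v; rewrite mcoeff_complete1 mcoeff1 mdeg_eq0.
Qed.

(** For the empty partition the second factor is unitriangular, which identifies
    the first one as [a_delta]. *)
Lemma alternant_jacobi_trudi N (la : intpart) :
  alternant R N la = \det (jacobi_trudi N la) * alternant R N [::].
Proof.
have [A AP] := alternant_factor N; have e0 : is_part [::] by [].
rewrite -[[::]]/(parts (IntPart e0)) !AP (@det_jacobi_trudi0 _ (IntPart e0)) //.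
by rewrite mulr1 mulrC.
Qed.

Lemma complete_mnm N M (v : 'X_{1..M}) :
  complete R (part_of v) N = \prod_(j < M) complete1 R (v j) N.
Proof.
have c0 : complete1 R 0 N = 1.
  by apply/mpolyP => u; rewrite mcoeff_complete1 mcoeff1 mdeg_eq0.
rewrite /complete -(perm_big _ (part_ofP v)) /= big_filter.
rewrite mnm_seqE big_map big_enum_cond big_mkcond /=.
by apply: eq_bigr => j _; case: eqP => // ->.
Qed.

Lemma det_jacobi_trudi n (b : intpartn n) :
  \det (jacobi_trudi n b) = \sum_a schur_coef a b *: complete R a n.
Proof.
rewrite -det_tr /determinant.
under [RHS]eq_bigr => a _ do rewrite /schur_coef /inv_kostka scaler_suml.
rewrite exchange_big /=; apply: eq_bigr => w _.
under [RHS]eq_bigr => a _ do rewrite -scalerA.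
rewrite -scaler_sumr -[RHS]mul_mpolyC rmorphXn rmorphN rmorph1; congr (_ * _).
under eq_bigr => j _ do rewrite !mxE.
have [sh|] := boolP (shiftable b w); last first.
  rewrite negb_forall => /existsP[i ib]; rewrite (bigD1 i) //= (negPf ib) mul0r.
  by rewrite big1 // => a _; rewrite scale0r.
have [a aE] : {a : intpartn n | a = part_of (shift_mnm b w) :> intpart}.
  by apply: intpartn_of; rewrite psize_part_of_mnm (mdeg_shift_mnm (size_intpartn b) sh) psizeE.
transitivity (complete R (part_of (shift_mnm b w)) n).
  rewrite complete_mnm; apply: eq_bigr => j _; rewrite mnmE.
  by move/forallP/(_ j): sh => ->.
rewrite -aE (bigD1 a) //= eqxx scale1r [X in _ + X]big1 ?addr0 //.
move=> c ca; case: eqP => [E|]; rewrite ?scale0r //.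
by case/eqP: ca; apply/val_inj; rewrite /= -E aE.
Qed.

(** Both sides are symmetric functions of degree [n], so it is enough to compare
    them in [n] variables, where the Leibniz expansion of the Jacobi-Trudi
    determinant has the same terms as the inverse Kostka numbers. *)
Lemma schur_complete_expands Y : inverses Y schur_coef ->
  expands (schur R) (complete R) (transpose schur_coef).
Proof.
move=> YX n b; apply: (Lambda_inj (n := n) (N := n)) => //.
- have -> : schur R b = fun N => \sum_a Y n b a *: monomial R a N.
    by apply/functional_extensionality_dep => N; rewrite (schur_expands YX).
  by apply: Lambda_sum => a; apply: Lambda_monomial_n.
- by apply: Lambda_sum => a; apply: Lambda_complete.
apply: schur_unique; rewrite /alternant_part size_intpartn alternant_jacobi_trudi.
by rewrite det_jacobi_trudi.
Qed.

End Schur.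

(** * Comparison of the five bases *)

Local Open Scope classical_set_scope.

Theorem proposition3p1p1 (R : realType) :
  let m := monomial R in
  let s := schur R in
  let h := complete R in
  let p := powersum R in
  let pz := powersumz R in
  (forall F : nat -> symfam R, (forall n, Lambda n (F n)) ->
     [/\ stable s F <-> stable m F,
         unif_stable s F <-> unif_stable h F,
         stable h F <-> stable pz F
       & unif_stable m F <-> unif_stable p F]) /\
  (forall la mu : intpart, (psize la <= psize mu)%N ->
     [/\ index_le (Nindex s m la mu) (2 * psize mu),
         index_le (Nindex m s la mu) (2 * psize mu),
         index_le (Nindex pz h la mu) (2 * psize mu + 1)
       & index_le (Nindex h pz la mu) (2 * psize mu + 1)]) /\
  (forall mu : intpart,
     [/\ Jset s m mu `<=` [set la | (psize la <= psize mu)%N],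
         Jset m s mu `<=` [set la | (psize la <= psize mu)%N],
         Jset pz h mu `<=` [set la | (psize la <= psize mu)%N]
       & Jset h pz mu `<=` [set la | (psize la <= psize mu)%N]]) /\
  (forall la : intpart,
     [/\ Iset p m la `<=` [set mu | (psize mu <= psize la)%N],
         Iset m p la `<=` [set mu | (psize mu <= psize la)%N],
         Iset h s la `<=` [set mu | (psize mu <= psize la)%N]
       & Iset s h la `<=` [set mu | (psize mu <= psize la)%N]]).
Proof.
move=> m s h p pz.
have [K [IL KL IK KI]] := dominance_inverse
  (@schur_coef_dominated R) (@schur_coef_diag R).
have [T [QL TL QT TQ]] := dominance_inverse
  (@power_coef_dominated R) (@power_coef_diag R).
have IS := schur_coef_stable R; have KS := inverse_pad_stable IL KL IK KI IS.
have QS := power_coef_stable R; have TS := inverse_pad_stable QL TL QT TQ QS.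
have sm : expands s m K := schur_expands KI.
have ms : expands m s (schur_coef R) := expands_inverse IK sm.
have sh : expands s h (transpose (schur_coef R)) := schur_complete_expands KI.
have hs : expands h s (transpose K) := expands_inverse (inverses_transpose IK) sh.
have hz : expands h pz (power_coef R) := @complete_expands R.
have zh : expands pz h T := expands_inverse TQ hz.
have pm : expands p m (transpose (power_coef R)) := @powersum_expands R.
have mp : expands m p (transpose T) := expands_inverse (inverses_transpose QT) pm.
(* The property of being a basis propagates from the monomial functions along
   the invertible changes of basis. *)
have mB : is_basis m := is_basis_monomial R.
have sB : is_basis s := is_basis_expands IK KI ms mB.
have hB : is_basis h := is_basis_expands (inverses_transpose KI) (inverses_transpose IK) sh sB.
have zB : is_basis pz := is_basis_expands QT TQ hz hB.
have pB : is_basis p := is_basis_expands (inverses_transpose QT) (inverses_transpose TQ) mp mB.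
split; [|split; [|split]].
- move=> F LF; split; split.
  + exact: stable_expands sm KL KS LF.
  + exact: stable_expands ms IL IS LF.
  + exact: unif_stable_expands sh IL IS LF.
  + exact: unif_stable_expands hs KL KS LF.
  + exact: stable_expands hz QL QS LF.
  + exact: stable_expands zh TL TS LF.
  + exact: unif_stable_expands mp TL TS LF.
  + exact: unif_stable_expands pm QL QS LF.
- move=> la mu lm; split.
  + by rewrite -[(2 * _)%N]addn0; apply: Nindex_expands sm KS lm.
  + by rewrite -[(2 * _)%N]addn0; apply: Nindex_expands ms IS lm.
  + exact: Nindex_expands zh TS lm.
  + exact: Nindex_expands hz QS lm.
- move=> mu; split.
  + exact: Jset_expands sm KL.
  + exact: Jset_expands ms IL.
  + exact: Jset_expands zh TL.
  + exact: Jset_expands hz QL.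
- move=> la; split.
  + exact: Iset_expands pm QL.
  + exact: Iset_expands mp TL.
  + exact: Iset_expands hs KL.
  + exact: Iset_expands sh IL.
Qed.
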